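(* Let $(M,g)$ be a Riemannian manifold of dimension $m\geq 2$, let $\nabla$ be a metric connection on $M$ (i.e. $\nabla g=0$, with possibly non-zero torsion $T^\nabla$), and let $f_1=e^{2\varphi_1}$, $f_2=e^{2\varphi_2}$ with $\varphi_1,\varphi_2\in C^\infty(M)$. Equip the manifold $TM$ with the Riemannian metric $G=g^{f_1,f_2}=f_1\pi^*g\oplus f_2\pi^*g$ on $TTM=H\oplus V$, where $H$ is the horizontal distribution of $\nabla$. Then the Levi-Civita connection $\nabla^G$ of $(TM,G)$ is given by $$\nabla^G_XY=D^*_XY-\tfrac12\mathcal{R}^\xi(X,Y)+A(X,Y)+B(X,Y)+\tau(X,Y)$$ for all vector fields $X,Y$ on $TM$, where $D^*,\mathcal{R}^\xi,A,B,\tau$ are the connection and tensors defined in the context.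
   Context: Let $\pi:TM\to M$ be the bundle projection and $V=\ker d\pi\subset TTM$ the vertical bundle, canonically identified with $\pi^*TM$. Let $\xi$ be the canonical vertical vector field on $TM$, $\xi_u=u$. Write $\nabla^*=\pi^*\nabla$ for the pull-back connection on $\pi^*TM$. Then $H=\{X\in TTM:\ \nabla^*_X\xi=0\}$ is a complement of $V$, and $d\pi$ restricts to an isomorphism $H\cong\pi^*TM$. Write $X=X^h+X^v$ for the decomposition along $H\oplus V$; one has $X^v=\nabla^*_X\xi$. Through the identifications $H\cong\pi^*TM\cong V$, $\nabla^*$ also denotes the induced connection on $H$, on $V$, and the direct sum $\nabla^*\oplus\nabla^*$ on $TTM=H\oplus V$. The bracket $\langle\ ,\ \rangle$ denotes $g$, and on $TTM$ the Sasaki metric $g^S=\pi^*g\oplus\pi^*g$ (with $H\perp V$). Functions on $M$ are composed with $\pi$ when used on $TM$; $X(\varphi)=d\varphi(X)$. Gradients are taken with respect to $g$; on $TM$, $\mathrm{grad}\,\varphi$ denotes the horizontal lift of the gradient. On $M$ put $C_1(X,Y)=X(\varphi_1)Y+Y(\varphi_1)X-\langle X,Y\rangle\,\mathrm{grad}\,\varphi_1$. On $H$ let $\nabla^{*,f_1}=\nabla^*+\pi^*C_1$ (where $\pi^*C_1$ depends only on horizontal parts). On $V$ let $\nabla^{*,f_2,'}_XY=\nabla^*_XY+X(\varphi_2)Y$. Set $D^*=\nabla^{*,f_1}\oplus\nabla^{*,f_2,'}$ on $TTM=H\oplus V$. Curvature convention: $R(X,Y)=\nabla_X\nabla_Y-\nabla_Y\nabla_X-\nabla_{[X,Y]}$.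 Let $R^*=\pi^*R^\nabla$ be the curvature of $\nabla^*$ and $\mathcal{R}^\xi(X,Y)=R^*_{X,Y}\xi$, regarded as a $V$-valued 2-form on $TM$ (it depends only on $X^h,Y^h$). $B(X,Y)=Y(\varphi_2)X^v-\frac{f_2}{f_1}\langle X^v,Y^v\rangle\,\mathrm{grad}\,\varphi_2$. $A$ is the $H$-valued tensor defined by $f_1\langle A(X,Y),Z\rangle=\frac{f_2}{2}\bigl(\langle R^*_{X^h,Z^h}\xi,Y^v\rangle+\langle R^*_{Y^h,Z^h}\xi,X^v\rangle\bigr)$. $\tau$ is the $H$-valued tensor defined by $\langle\tau(X,Y),Z^h\rangle=\frac12\bigl(T(Y,X,Z)+T(X,Z,Y)+T(Y,Z,X)\bigr)$, where $T(X,Y,Z)=\langle\pi^*T^\nabla(X,Y),Z\rangle$ and $\pi^*T^\nabla$ is regarded as $H$-valued (so $T$ depends only on the horizontal parts of its arguments). Here $T^\nabla(X,Y)=\nabla_XY-\nabla_YX-[X,Y]$. *)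

(* Defs.v *)
From mathcomp Require Import all_boot all_order all_algebra.
From mathcomp Require Import all_classical all_reals all_analysis.

Set Implicit Arguments.
Unset Strict Implicit.
Unset Printing Implicit Defensive.

Import Order.TTheory GRing.Theory Num.Theory numFieldNormedType.Exports.

Local Open Scope classical_set_scope.
Local Open Scope ring_scope.

(* C^oo on O: every iterated directional derivative is differentiable at every
   point of O.  For finite-dimensional E this is the usual notion. *)
Definition smooth_on (R : realType) (E W : normedModType R) (O : set E)
    (h : E -> W) : Prop :=
  forall (vs : seq E) (x : E), O x ->
    differentiable (foldr (fun v k => 'D_v k) h vs) x.

(* A set with an atlas modelled on E and, at each point, a preferred chart.
   The functions [chart_map i] and [chart_inv i] are total; only their values on
   [chart_dom i] and on [chart_map i @` chart_dom i] are meaningful. *)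
Record chartedSpace (R : realType) (E : normedModType R) := ChartedSpace {
  carrier :> Type;
  atlas : Type;
  chart_dom : atlas -> set carrier;
  chart_map : atlas -> carrier -> E;
  chart_inv : atlas -> E -> carrier;
  chart_at : carrier -> atlas }.

(* The tangent space T_pM is the type E: v : E is the tangent vector at p whose
   components in the preferred chart [chart_at p] are v.  A vector field is
   thus a function M -> E, and all the comparisons between different charts go
   through [rep] and [unrep] below. *)
Section Manifolds.
Context {R : realType} {E : normedModType R} (M : chartedSpace E).

Definition mopen (A : set M) : Prop :=
  forall i : atlas M, open (chart_map i @` (A `&` chart_dom i)).

Record is_manifold : Prop := IsManifold {
  chart_at_dom : forall p : M, chart_dom (chart_at p) p;
  chart_mapK : forall (i : atlas M) p, chart_dom i p ->
    chart_inv i (chart_map i p) = p;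
  chart_open : forall i : atlas M, open (chart_map i @` chart_dom i);
  overlap_open : forall i j : atlas M,
    open (chart_map i @` (chart_dom i `&` chart_dom j));
  transition_smooth : forall i j : atlas M,
    smooth_on (chart_map i @` (chart_dom i `&` chart_dom j))
      (chart_map j \o chart_inv i);
  manifold_hausdorff : forall p q : M, p <> q ->
    exists A B : set M, [/\ mopen A, mopen B, A p, B q & A `&` B = set0];
  manifold_second_countable : exists U : nat -> set M,
    (forall n, mopen (U n)) /\
    (forall (A : set M) p, mopen A -> A p -> exists n, U n p /\ U n `<=` A) }.

(* components in the chart i of the tangent vector v at q *)
Definition rep (i : atlas M) (q : M) (v : E) : E :=
  'd (chart_map i \o chart_inv (chart_at q)) (chart_map (chart_at q) q) v.

(* tangent vector at q whose components in the chart i are w *)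
Definition unrep (i : atlas M) (q : M) (w : E) : E :=
  'd (chart_map (chart_at q) \o chart_inv i) (chart_map i q) w.

(* vector field with constant components v in the chart [chart_at p] *)
Definition ext (p : M) (v : E) : M -> E := fun q => unrep (chart_at p) q v.

(* smoothness in some neighbourhood of p *)
Definition smooth_at (W : normedModType R) (p : M) (f : M -> W) : Prop :=
  exists O : set E, [/\ open O, O (chart_map (chart_at p) p) &
    smooth_on O (f \o chart_inv (chart_at p))].

Definition smooth (W : normedModType R) (f : M -> W) : Prop :=
  forall p, smooth_at p f.

(* the derivative of the function f at p in the direction v, i.e. v(f) *)
Definition dfun (W : normedModType R) (f : M -> W) (p : M) (v : E) : W :=
  'd (f \o chart_inv (chart_at p)) (chart_map (chart_at p) p) v.

Definition smooth_field_at (p : M) (X : M -> E) : Prop :=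
  smooth_at p (fun q => rep (chart_at p) q (X q)).

Definition smooth_field (X : M -> E) : Prop := forall p, smooth_field_at p X.

(* the a-th component of [X, Y] is X(Y^a) - Y(X^a) *)
Definition lie (X Y : M -> E) (p : M) : E :=
  dfun (fun q => rep (chart_at p) q (Y q)) p (X p) -
  dfun (fun q => rep (chart_at p) q (X q)) p (Y p).

Record is_riemannian (g : M -> E -> E -> R) : Prop := IsRiemannian {
  riem_linear : forall p a x y z, g p (a *: x + y) z = a * g p x z + g p y z;
  riem_sym : forall p x y, g p x y = g p y x;
  riem_pos : forall p x, x != 0 -> 0 < g p x x;
  riem_smooth : forall p X Y, smooth_field_at p X -> smooth_field_at p Y ->
    smooth_at (W := R^o) p (fun q => g q (X q) (Y q)) }.

(* Affine connections as differential operators: [nabla p v Y] is nabla_v Y in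
   T_pM, for v in T_pM and Y a vector field smooth near p.  Admitting locally
   defined fields is no restriction, a connection being local in Y. *)
Record is_connection (nabla : M -> E -> (M -> E) -> E) : Prop := IsConnection {
  nabla_linear : forall p a v w Y, smooth_field_at p Y ->
    nabla p (a *: v + w) Y = a *: nabla p v Y + nabla p w Y;
  nabla_add : forall p v Y Z, smooth_field_at p Y -> smooth_field_at p Z ->
    nabla p v (fun q => Y q + Z q) = nabla p v Y + nabla p v Z;
  nabla_leibniz : forall p v (f : M -> R^o) Y,
    smooth_at p f -> smooth_field_at p Y ->
    nabla p v (fun q => (f q : R) *: Y q) =
      (dfun f p v : R) *: Y p + (f p : R) *: nabla p v Y;
  nabla_smooth : forall p X Y, smooth_field_at p X -> smooth_field_at p Y ->
    smooth_field_at p (fun q => nabla q (X q) Y) }.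

Definition is_metric_for (g : M -> E -> E -> R)
    (nabla : M -> E -> (M -> E) -> E) : Prop :=
  forall p v Y Z, smooth_field_at p Y -> smooth_field_at p Z ->
    dfun (W := R^o) (fun q => g q (Y q) (Z q)) p v =
      g p (nabla p v Y) (Z p) + g p (Y p) (nabla p v Z).

Definition torsion_fields (nabla : M -> E -> (M -> E) -> E)
    (X Y : M -> E) (p : M) : E :=
  nabla p (X p) Y - nabla p (Y p) X - lie X Y p.

Definition curvature_fields (nabla : M -> E -> (M -> E) -> E)
    (X Y Z : M -> E) (p : M) : E :=
  nabla p (X p) (fun q => nabla q (Y q) Z) -
  nabla p (Y p) (fun q => nabla q (X q) Z) - nabla p (lie X Y p) Z.

(* Torsion and curvature are tensors: their values on tangent vectors are
   computed on any extensions, here the coordinate fields. *)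
Definition torsion (nabla : M -> E -> (M -> E) -> E) (p : M) (x y : E) : E :=
  torsion_fields nabla (ext p x) (ext p y) p.

Definition curvature (nabla : M -> E -> (M -> E) -> E)
    (p : M) (x y z : E) : E :=
  curvature_fields nabla (ext p x) (ext p y) (ext p z) p.

Record is_levi_civita (g : M -> E -> E -> R)
    (nabla : M -> E -> (M -> E) -> E) : Prop := IsLeviCivita {
  levi_civita_connection : is_connection nabla;
  levi_civita_metric : is_metric_for g nabla;
  levi_civita_torsion : forall p X Y,
    smooth_field_at p X -> smooth_field_at p Y ->
    torsion_fields nabla X Y p = 0 }.

Definition grad (g : M -> E -> E -> R) (f : M -> R) (p : M) : E :=
  xget 0 [set a | forall x : E, g p a x = dfun (W := R^o) f p x].

End Manifolds.

Section Maps.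
Context {R : realType} {E F : normedModType R}.
Variables (N : chartedSpace F) (M : chartedSpace E).

Definition tmap (h : N -> M) (u : N) (w : F) : E :=
  'd (chart_map (chart_at (h u)) \o h \o chart_inv (chart_at u))
     (chart_map (chart_at u) u) w.

(* Pull-back connection on h^*TM; a section s has s u in T_{h u}M.  It is the
   connection determined by nabla^*_w (Y o h) = nabla_{dh w} Y.  Writing
   s = sum_a s^a (e_a o h), with e_a the coordinate fields of the chart at h u,
   the Leibniz rule gives
     nabla^*_w s = sum_a w(s^a) e_a + nabla_{dh w} (sum_a s^a(u) e_a). *)
Definition pullback (h : N -> M) (nabla : M -> E -> (M -> E) -> E)
    (u : N) (w : F) (s : N -> E) : E :=
  dfun (fun u' => rep (chart_at (h u)) (h u') (s u')) u w +
  nabla (h u) (tmap h u w) (ext (h u) (s u)).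

End Maps.

(* Points of TM are pairs (p, v) with v in T_pM; the chart induced by a chart i
   of M sends (p, v) to the coordinates of p and the components of v. *)
Definition TM (R : realType) (E : normedModType R) (M : chartedSpace E) :
    chartedSpace (E * E)%type :=
  @ChartedSpace R (E * E)%type (M * E)%type (atlas M)
    (fun i => [set u | chart_dom i u.1])
    (fun i u => (chart_map i u.1, rep i u.1 u.2))
    (fun i z => (chart_inv i z.1, unrep i (chart_inv i z.1) z.2))
    (fun u => chart_at u.1).

Section TangentBundle.
Context {R : realType} {E : normedModType R} (M : chartedSpace E).
Variables (g : M -> E -> E -> R) (nabla : M -> E -> (M -> E) -> E).

Implicit Types (u : TM M) (w X Y Z : (E * E)%type) (a : E).

Definition bundle_proj : TM M -> M := fun u => u.1.

Definition dproj u w : E := tmap bundle_proj u w.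

(* canonical vertical field, as a section of pi^*TM *)
Definition xi : TM M -> E := fun u => u.2.

Definition nablas u w (s : TM M -> E) : E := pullback bundle_proj nabla u w s.

Definition horizontal u w : Prop := nablas u w xi = 0.

(* the inverse of d(pi) : H -> pi^*TM *)
Definition hlift u a : (E * E)%type :=
  xget 0 [set w | horizontal u w /\ dproj u w = a].

(* the identification pi^*TM -> V: velocity at t = 0 of t |-> u + t a in the
   fibre of u *)
Definition vlift u a : (E * E)%type :=
  'D_1 (fun t : R^o =>
          chart_map (chart_at u) ((u.1, u.2 + (t : R) *: a) : TM M)) 0.

Definition hpart u X : (E * E)%type := hlift u (dproj u X).

Definition vpart u X : (E * E)%type := X - hpart u X.

(* X^v as an element of pi^*TM *)
Definition vcomp u X : E := xget 0 [set a | vlift u a = vpart u X].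

Definition sasaki u X Y : R :=
  g u.1 (dproj u X) (dproj u Y) + g u.1 (vcomp u X) (vcomp u Y).

(* f1 pi^*g (+) f2 pi^*g *)
Definition sasaki_weighted (f1 f2 : M -> R) u X Y : R :=
  f1 u.1 * g u.1 (dproj u X) (dproj u Y) +
  f2 u.1 * g u.1 (vcomp u X) (vcomp u Y).

(* X(phi o pi) *)
Definition dlift (phi : M -> R) u X : R :=
  dfun (W := R^o) (fun u' : TM M => phi (bundle_proj u')) u X.

Definition C1 (phi1 : M -> R) (p : M) (x y : E) : E :=
  (dfun (W := R^o) phi1 p x : R) *: y + (dfun (W := R^o) phi1 p y : R) *: x -
  g p x y *: grad g phi1 p.

(* the connection on H, in terms of sections s of pi^*TM = H *)
Definition nablaH (phi1 : M -> R) u X (s : TM M -> E) : E :=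
  nablas u X s + C1 phi1 u.1 (dproj u X) (s u).

(* the connection on V, in terms of sections s of pi^*TM = V *)
Definition nablaV (phi2 : M -> R) u X (s : TM M -> E) : E :=
  nablas u X s + dlift phi2 u X *: s u.

Definition Dstar (phi1 phi2 : M -> R) u X (Y : TM M -> (E * E)%type) :
    (E * E)%type :=
  hlift u (nablaH phi1 u X (fun u' => dproj u' (Y u'))) +
  vlift u (nablaV phi2 u X (fun u' => vcomp u' (Y u'))).

(* R^*_{X,Y} z, for z in the fibre of pi^*TM at u *)
Definition Rstar u X Y (z : E) : E :=
  curvature nabla u.1 (dproj u X) (dproj u Y) z.

Definition Rxi u X Y : (E * E)%type := vlift u (Rstar u X Y (xi u)).

Definition tensorA (f1 f2 : M -> R) u X Y : (E * E)%type :=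
  xget 0 [set W | horizontal u W /\ forall Z,
    f1 u.1 * sasaki u W Z = f2 u.1 / 2 *
      (g u.1 (Rstar u (hpart u X) (hpart u Z) (xi u)) (vcomp u Y) +
       g u.1 (Rstar u (hpart u Y) (hpart u Z) (xi u)) (vcomp u X))].

Definition tensorB (phi2 f1 f2 : M -> R) u X Y : (E * E)%type :=
  dlift phi2 u Y *: vpart u X -
  (f2 u.1 / f1 u.1 * sasaki u (vpart u X) (vpart u Y)) *:
    hlift u (grad g phi2 u.1).

Definition torsion3 u X Y Z : R :=
  sasaki u (hlift u (torsion nabla u.1 (dproj u X) (dproj u Y))) Z.

Definition tensor_tau u X Y : (E * E)%type :=
  xget 0 [set W | horizontal u W /\ forall Z,
    sasaki u W (hpart u Z) =
      2^-1 * (torsion3 u Y X Z + torsion3 u X Z Y + torsion3 u Y Z X)].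

End TangentBundle.

(* Main.v *)
Require Import Defs.
From HB Require Import structures.
From mathcomp Require Import all_boot all_order all_algebra.
From mathcomp Require Import all_classical all_reals all_analysis.
From mathcomp Require Import ring lra.
Import Order.TTheory GRing.Theory Num.Theory numFieldNormedType.Exports.
Local Open Scope ring_scope.

(** The right-hand side P of the formula is compared with the Levi-Civita
connection through the fundamental lemma: both satisfy the product rule for G
and have zero torsion, so for S = nablaG - P the expression G(S(X,Y), Z) is
symmetric in X, Y and skew in Y, Z, hence zero.

In the chart of TM induced by a chart of M, with Christoffel map c |-> Gamma_c,
a tangent vector (X1, X2) at u = (p, v) has d(pi)-image X1 and vertical part
X2 + Gamma_p(X1, v); the latter expression is chart independent because it is
nabla^*_X xi.  Differentiating these components along a second field gives
nabla^*_X Y for both parts of Y.  Their skew parts differ from the components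
of [X,Y] by the torsion (horizontal) and by the curvature applied to v
(vertical), and these defects are what tau and -1/2 R^xi correct, while A, B
and C1 restore the product rule. *)

Set Implicit Arguments.
Unset Strict Implicit.
Unset Printing Implicit Defensive.

Local Open Scope classical_set_scope.

(** * Calculus in normed modules *)

Section Calculus.
Context {R : realType}.
Implicit Types U V W : normedModType R.

(** The obstacle is that a tangent vector at q is stored by its components in the preferred chart of
    q, which may jump from point to point. Before X^v can be differentiated along a field, its
    formula must therefore be known in one fixed chart near u; this is the role of [nablas_chart]
    and [vertical_part_chart].

    The shape of each correction term has its reason. The vertical defect of nabla^* is R(X,Y)v; the
    term -1/2 R^xi is skew, so its two copies remove the defect when the formula is antisymmetrized.
    It breaks the product rule, and A, being symmetric in X and Y, repairs this without creating
    torsion. In B, the term Y(phi2) X^v makes X(phi2) Y^v symmetric, and the gradient term is minus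
    its adjoint, so that B(X, .) is skew for G. In tau, the term T(Y,X,Z) is skew in X, Y and
    supplies -T(X,Y) after antisymmetrizing, while the other two have a symmetric sum and make
    tau(X, .) skew. *)

Lemma is_diff_near0 V W (h : V -> W) (x : V) :
  (\forall y \near x, h y = 0) -> is_diff x h 0.
Proof.
move=> h0.
have hx : h x = 0 := nbhs_singleton h0.
have H : h \o shift x = cst (h x) + (0 : V -> W) +o_ 0 id.
  apply/eqaddoP => _/posnumP[e].
  have h0' : \forall y \near 0, h (y + x) = 0.
    by move: h0; rewrite (near_shift 0 x) subr0.
  near=> y.
  have -> : (h \o shift x - (cst (h x) + 0)) y = h (y + x) - (h x + 0) by [].
  by rewrite (near h0' y)// hx addr0 subrr normr0 mulr_ge0.
have E : 'd h x = 0 :> (V -> W).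
  by apply: (diff_unique (df := \0)) => //; exact: cst_continuous.
apply: DiffDef => //; apply/diff_locallyP; rewrite E; split => //.
exact: cst_continuous.
Unshelve. all: by end_near. Qed.

(** Writing g as f + (g - f), whose second summand vanishes near x, reduces locality of the
    differential to the case of the zero germ. *)
Lemma is_diff_near V W (f g : V -> W) (x : V) df :
  (\forall y \near x, f y = g y) -> is_diff x f df -> is_diff x g df.
Proof.
move=> fg dfx.
have -> : g = f + (g - f) by rewrite addrC subrK.
rewrite -[df]addr0.
apply: is_diffD; apply: is_diff_near0; near=> y.
have -> : (g - f) y = g y - f y by [].
by rewrite (near fg y)// subrr.
Unshelve. all: by end_near. Qed.

Lemma diff_near V W (f g : V -> W) (x : V) v :
  (\forall y \near x, f y = g y) -> differentiable f x ->
  'd g x v = 'd f x v.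
Proof.
move=> fg /differentiableP df.
by have /(@diff_val _ _ _ _) -> := is_diff_near fg df.
Qed.

Lemma differentiable_near V W (f g : V -> W) (x : V) :
  (\forall y \near x, f y = g y) -> differentiable f x -> differentiable g x.
Proof. by move=> fg /differentiableP df; have [] := is_diff_near fg df. Qed.

Lemma is_diffE V W (f : V -> W) (x : V) df v : is_diff x f df -> 'd f x v = df v.
Proof. by move=> h; rewrite diff_val. Qed.

(** Registered as a bilinear map so that the derivative of a continuous bilinear map yields the
    product rule for scaling. *)
Lemma scale_is_bilinear W :
  bilinear_for
    (GRing.Scale.Law.clone _ _ *:%R _) (GRing.Scale.Law.clone _ _ *:%R _)
    (@GRing.scale R W : R^o -> W -> W).
Proof.
split=> [u'|u] a x y /=; first by rewrite scalerDl scalerA.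
by rewrite scalerDr !scalerA mulrC.
Qed.
HB.instance Definition _ W :=
  bilinear_isBilinear.Build R R^o W W _ _ (@GRing.scale R W : R^o -> W -> W)
    (scale_is_bilinear W).

Lemma is_diff_scale V W (k : V -> R^o) (f : V -> W) x dk df :
  is_diff x k dk -> is_diff x f df ->
  is_diff x (fun y => k y *: f y) (fun v => dk v *: f x + k x *: df v).
Proof.
move=> dkx dfx.
pose b : {bilinear R^o -> W -> W} := (@GRing.scale R W : R^o -> W -> W).
have bc : continuous (fun p : R^o * W => b p.1 p.2).
  by move=> p; apply: scale_continuous.
have db p : is_diff p (fun q : R^o * W => q.1 *: q.2)
     (fun q => p.1 *: q.2 + q.1 *: p.2).
  apply: DiffDef; first exact: (differentiable_bilin (f := b) p bc).
  exact: (diff_bilin (f := b) p bc).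
have dp := @is_diff_pair _ _ _ _ _ _ _ _ _ dkx dfx.
have dc := is_diff_comp dp (db (k x, f x)).
apply: (is_diff_eq (f := fun y => k y *: f y) dc).
by rewrite funeqE => v /=; rewrite addrC.
Qed.

Lemma is_diff_sum V W n (f df : 'I_n -> V -> W) x :
  (forall i, is_diff x (f i) (df i)) ->
  is_diff x (fun y => \sum_i f i y) (fun v => \sum_i df i v).
Proof.
elim: n f df => [|n IH] f df H.
  have -> : (fun v => \sum_i df i v) = 0 by apply/funext => v; rewrite big_ord0.
  by apply: is_diff_near0; near=> y; rewrite big_ord0.
have -> : (fun y => \sum_i f i y) =
   (fun y => \sum_(i < n) f (widen_ord (leqnSn n) i) y) + f ord_max.
  by apply/funext => y; rewrite big_ord_recr.
have -> : (fun y => \sum_i df i y) =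
   (fun y => \sum_(i < n) df (widen_ord (leqnSn n) i) y) + df ord_max.
  by apply/funext => y; rewrite big_ord_recr.
by apply: is_diffD; exact: IH.
Unshelve. all: by end_near. Qed.

Lemma linear_rowE W m (f : 'rV[R]_m -> W) a : linear f ->
  f a = \sum_k (a 0 k *: f (delta_mx 0 k)).
Proof.
move=> fl; pose fM := GRing.isLinear.Build _ _ _ _ _ fl.
pose F : {linear _ -> _} := HB.pack f fM.
rewrite -[f]/(F : _ -> _) {1}(row_sum_delta a) linear_sum.
by apply: eq_bigr => k _; rewrite linearZ.
Qed.

Lemma linearPE W W' (f : W -> W') : linear f ->
  [/\ f 0 = 0, (forall a b, f (a + b) = f a + f b),
   (forall k a, f (k *: a) = k *: f a),
   (forall a, f (- a) = - f a) & (forall a b, f (a - b) = f a - f b)].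
Proof.
move=> fl; pose fM := GRing.isLinear.Build _ _ _ _ _ fl.
pose F : {linear _ -> _} := HB.pack f fM.
rewrite -[f]/(F : _ -> _); split=> *;
  rewrite ?linear0 ?linearD ?linearZ ?linearN//.
Qed.

Lemma is_diff_coord V m (s : V -> 'rV[R]_m) x ds k : is_diff x s ds ->
  is_diff x (fun y => s y 0 k : R^o) (fun v => ds v 0 k).
Proof.
move=> dsx.
have @f : {linear 'rV[R]_m -> R^o}.
  by exists (fun N : 'rV[R]_m => N 0 k); do 2![eexists]; do ?[constructor];
     rewrite ?mxE// => ? *; rewrite ?mxE//; move=> ?; rewrite !mxE.
have fc : continuous f by exact: coord_continuous.
have df y : is_diff y f f.
  by apply: DiffDef; [exact: linear_differentiable|exact: diff_lin].
exact: (is_diff_comp dsx (df (s x))).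
Qed.

(** Expanding [s] in the standard basis turns [L z (s z)] into a finite sum of products, so
    differentiability of [L] in z at each fixed vector is enough. Linearity of [L z] is asked near x
    only, since families built from a chart are linear on its domain. *)
Lemma is_diff_linfam V W m (L : V -> 'rV[R]_m -> W) (s : V -> 'rV[R]_m) x ds :
  (\forall z \near x, linear (L z)) -> (forall a, differentiable (L^~ a) x) ->
  is_diff x s ds ->
  is_diff x (fun z => L z (s z)) (fun v => 'd (L^~ (s x)) x v + L x (ds v)).
Proof.
move=> Ll Ld dsx.
have main s' ds' : is_diff x s' ds' -> is_diff x (fun z => L z (s' z))
  (fun v => \sum_k (ds' v 0 k *: L x (delta_mx 0 k) +
              s' x 0 k *: 'd (L^~ (delta_mx 0 k)) x v)).
  move=> ds'x; apply: (@is_diff_near _ _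
    (fun z => \sum_k (s' z 0 k *: L z (delta_mx 0 k)))).
    by near=> z; rewrite -linear_rowE//; near: z.
  apply: is_diff_sum => k; apply: is_diff_scale; first exact: is_diff_coord.
  exact: differentiableP.
have Lx : linear (L x) := nbhs_singleton Ll.
apply: is_diff_eq (main _ _ dsx) _; apply/funext => v.
(* The constant section [s x] has zero derivative, so [main] applied to it computes the first term
   of the claim. *)
have := main _ _ (is_diff_cst (s x) x).
move=> /(is_diffE v) -> ; rewrite [X in _ + X](linear_rowE _ Lx) -big_split/=.
apply: eq_bigr => k _; rewrite addrC; congr (_ + _).
have z0 : (0 : V -> 'rV[R]_m) v 0 k = 0.
  by rewrite -[(0 : V -> 'rV[R]_m) v]/(0 : 'rV[R]_m) mxE.
by rewrite z0 scale0r add0r.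
Unshelve. all: by end_near. Qed.

(** Two uses of the linear case: in [s] with the second argument frozen, then in [t] for the linear
    family [B z (s z)]. *)
Lemma is_diff_bilinfam V W m n (B : V -> 'rV[R]_m -> 'rV[R]_n -> W)
    (s : V -> 'rV[R]_m) (t : V -> 'rV[R]_n) x ds dt :
  (\forall z \near x, forall b, linear ((B z)^~ b)) ->
  (\forall z \near x, forall a, linear (B z a)) ->
  (forall a b, differentiable (fun z => B z a b) x) ->
  is_diff x s ds -> is_diff x t dt ->
  is_diff x (fun z => B z (s z) (t z))
    (fun v => 'd (fun z => B z (s x) (t x)) x v +
              B x (ds v) (t x) + B x (s x) (dt v)).
Proof.
move=> Bl Br Bd dsx dtx.
have H b : is_diff x (fun z => B z (s z) b)
    (fun v => 'd (fun z => B z (s x) b) x v + B x (ds v) b).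
  apply: (@is_diff_linfam _ _ _ (fun z a => B z a b)) => //.
  by near=> z => k a a'; rewrite (near Bl z).
have Br' : \forall z \near x, linear (B z (s z)).
  by near=> z => k a a'; rewrite (near Br z).
have := is_diff_linfam Br' (fun b => @ex_diff _ _ _ _ _ _ _ (H b)) dtx.
move=> dB; apply: is_diff_eq dB _; apply/funext => v.
by congr (_ + _); exact: is_diffE v (H (t x)).
Unshelve. all: by end_near. Qed.

Lemma is_diff_fst V W (z : V * W) : is_diff z fst fst.
Proof.
have c : continuous (fst : V * W -> V) by move=> y; exact: cvg_fst.
by apply: DiffDef; [exact: linear_differentiable|exact: diff_lin].
Qed.

Lemma is_diff_snd V W (z : V * W) : is_diff z snd snd.
Proof.
have c : continuous (snd : V * W -> W) by move=> y; exact: cvg_snd.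
by apply: DiffDef; [exact: linear_differentiable|exact: diff_lin].
Qed.

Lemma near_fst V W (z : V * W) (P : V -> Prop) :
  (\forall c \near z.1, P c) -> \forall y \near z, P y.1.
Proof.
move=> H; have c : {for z, continuous (fst : V * W -> V)}.
  by apply: differentiable_continuous; have [] := is_diff_fst z.
exact: (c P H).
Qed.

(* C^n on O: [smooth_on] with the number of derivatives bounded, to allow
   inductions on n. *)
Definition cdiff n V W (O : set V) (h : V -> W) :=
  forall (vs : seq V) (x : V), (size vs <= n)%N -> O x ->
    differentiable (foldr (fun v k => 'D_v k) h vs) x.

Lemma smooth_cdiff V W (O : set V) (h : V -> W) :
  smooth_on O h <-> forall n, cdiff n O h.
Proof.
by split=> [H n vs x _|H vs x]; [exact: H|exact: (H (size vs))].
Qed.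

Lemma cdiff0 V W (O : set V) (h : V -> W) :
  cdiff 0 O h <-> forall x, O x -> differentiable h x.
Proof.
by split=> [H x Ox|H vs x]; [exact: (H [::])|case: vs => //= _; exact: H].
Qed.

Lemma cdiffS n V W (O : set V) (h : V -> W) :
  cdiff n.+1 O h <->
  (forall x, O x -> differentiable h x) /\ forall v, cdiff n O ('D_v h).
Proof.
split=> [H|[H1 H2]].
  split=> [x Ox|v vs x vsn Ox]; first exact: (H [::]).
  (* [foldr] applies the last direction of the list first, so the derivatives of ['D_v h] are those
     of h along lists ending in v. *)
  have := H (rcons vs v) x; rewrite size_rcons foldr_rcons; exact.
move=> vs x; case: (lastP vs) => [_ Ox|vs' v]; first exact: H1.
rewrite size_rcons foldr_rcons ltnS; exact: H2.
Qed.

Lemma cdiffW n V W (O : set V) (h : V -> W) : cdiff n.+1 O h -> cdiff n O h.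
Proof. by move=> H vs x vsn; apply: H; exact: leqW. Qed.

Lemma cdiff_sub n V W (O O' : set V) (h : V -> W) : O' `<=` O ->
  cdiff n O h -> cdiff n O' h.
Proof. by move=> OO' H vs x vsn /OO'; exact: H. Qed.

Lemma cdiff_eq n V W (O : set V) (f h : V -> W) : open O ->
  (forall x, O x -> f x = h x) -> cdiff n O f -> cdiff n O h.
Proof.
move=> oO; elim: n f h => [|n IH] f h fh.
  move=> /cdiff0 H; apply/cdiff0 => x Ox; apply: differentiable_near (H x Ox).
  by near=> y; apply: fh; near: y; exact: open_nbhs_nbhs.
move=> /cdiffS[H1 H2]; apply/cdiffS; split.
  move=> x Ox; apply: differentiable_near (H1 x Ox).
  by near=> y; apply: fh; near: y; exact: open_nbhs_nbhs.
move=> v; apply: IH (H2 v) => x Ox; apply: near_eq_derive.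
by near=> y; apply: fh; near: y; exact: open_nbhs_nbhs.
Unshelve. all: by end_near. Qed.

Lemma cdiff_cst n V W (O : set V) (a : W) : cdiff n O (cst a : V -> W).
Proof.
elim: n a => [|n IH] a; first by apply/cdiff0.
apply/cdiffS; split=> // v.
have -> : 'D_v (cst a : V -> W) = cst 0 by apply/funext => x; rewrite derive_cst.
exact: IH.
Qed.

Lemma derive_diff V W (f : V -> W) x v df : is_diff x f df -> 'D_v f x = df v.
Proof. by move=> h; rewrite deriveE// diff_val. Qed.

Lemma cdiffD n V W (O : set V) (f h : V -> W) : open O ->
  cdiff n O f -> cdiff n O h -> cdiff n O (fun x => f x + h x).
Proof.
move=> oO; elim: n f h => [|n IH] f h.
  move=> /cdiff0 H /cdiff0 H'; apply/cdiff0 => x Ox.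
  by apply: differentiableD; [exact: H|exact: H'].
move=> /cdiffS[H1 H2] /cdiffS[H1' H2']; apply/cdiffS; split.
  by move=> x Ox; apply: differentiableD; [exact: H1|exact: H1'].
move=> v; apply: cdiff_eq (IH _ _ (H2 v) (H2' v)) => // x Ox.
by rewrite deriveD//; apply: diff_derivable; [exact: H1|exact: H1'].
Qed.

Lemma cdiff_sum n V W (O : set V) k (f : 'I_k -> V -> W) : open O ->
  (forall i, cdiff n O (f i)) -> cdiff n O (fun x => \sum_i f i x).
Proof.
move=> oO; elim: k f => [|k IH] f H.
  by apply: cdiff_eq (@cdiff_cst n _ _ O 0) => // x _; rewrite big_ord0.
apply: cdiff_eq (cdiffD oO (IH _ (fun i => H (widen_ord (leqnSn k) i)))
   (H ord_max)) => // x _.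
by rewrite big_ord_recr.
Qed.

Lemma cdiff_scale n V W (O : set V) (k : V -> R^o) (f : V -> W) : open O ->
  cdiff n O k -> cdiff n O f -> cdiff n O (fun x => k x *: f x).
Proof.
move=> oO; elim: n k f => [|n IH] k f.
  move=> /cdiff0 H /cdiff0 H'; apply/cdiff0 => x Ox.
  by have [] := is_diff_scale (differentiableP (H x Ox))
    (differentiableP (H' x Ox)).
move=> Hk Hf; have [H1 H2] := iffLR (cdiffS _ _ _) Hk.
have [H1' H2'] := iffLR (cdiffS _ _ _) Hf.
apply/cdiffS; split.
  move=> x Ox.
  by have [] := is_diff_scale (differentiableP (H1 x Ox))
    (differentiableP (H1' x Ox)).
move=> v; apply: cdiff_eq (cdiffD oO (IH _ _ (H2 v) (cdiffW Hf))
   (IH _ _ (cdiffW Hk) (H2' v))) => // x Ox.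
have := is_diff_scale (differentiableP (H1 x Ox)) (differentiableP (H1' x Ox)).
by move=> /(derive_diff v) ->; rewrite !deriveE//; [exact: H1'|exact: H1].
Qed.

Lemma cdiff_coord n V m (O : set V) (f : V -> 'rV[R]_m) k : open O ->
  cdiff n O f -> cdiff n O (fun x => f x 0 k : R^o).
Proof.
move=> oO; elim: n f => [|n IH] f.
  move=> /cdiff0 H; apply/cdiff0 => x Ox.
  by have [] := is_diff_coord k (differentiableP (H x Ox)).
move=> /cdiffS[H1 H2]; apply/cdiffS; split.
  by move=> x Ox; have [] := is_diff_coord k (differentiableP (H1 x Ox)).
move=> v; apply: cdiff_eq (IH _ (H2 v)) => // x Ox.
have := is_diff_coord k (differentiableP (H1 x Ox)).
by move=> /(derive_diff v) ->; rewrite deriveE//; exact: H1.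
Qed.

(** By the chain rule, the derivative of h o f along v is the sum over k of the k-th coordinate of
    ['D_v f] times the k-th partial derivative of h at f. Each factor is C^n, so the induction
    closes through [cdiff_sum] and [cdiff_scale]. *)
Lemma cdiff_comp n V W m (O : set V) (O' : set 'rV[R]_m)
  (f : V -> 'rV[R]_m) (h : 'rV[R]_m -> W) : open O -> open O' ->
  (forall x, O x -> O' (f x)) ->
  cdiff n O f -> cdiff n O' h -> cdiff n O (h \o f).
Proof.
move=> oO oO' fO; elim: n h => [|n IH] h.
  move=> /cdiff0 H /cdiff0 H'; apply/cdiff0 => x Ox.
  by apply: differentiable_comp; [exact: H|apply: H'; exact: fO].
move=> Hf Hh; have [H1 H2] := iffLR (cdiffS _ _ _) Hf.
have [H1' H2'] := iffLR (cdiffS _ _ _) Hh.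
apply/cdiffS; split.
  by move=> x Ox; apply: differentiable_comp; [exact: H1|apply: H1'; exact: fO].
move=> v; apply: (@cdiff_eq _ _ _ _
  (fun x => \sum_k ('D_v f x 0 k *: ('D_(delta_mx 0 k) h \o f) x))) => //.
  move=> x Ox; have dh : differentiable h (f x) by apply: H1'; exact: fO.
  rewrite [RHS]deriveE; last by apply: differentiable_comp => //; exact: H1.
  rewrite diff_comp//; last exact: H1.
  rewrite /= (linear_rowE _ (@linearP _ _ _ _ ('d h (f x)))).
  by apply: eq_bigr => k _; rewrite !deriveE//; exact: H1.
apply: cdiff_sum => // k; apply: cdiff_scale => //; first exact: cdiff_coord.
by apply: IH => //; exact: cdiffW.
Qed.

Lemma is_diff_expR V (f : V -> R^o) x df : is_diff x f df ->
  is_diff x (fun y => expR (f y) : R^o) (fun v => expR (f x) * df v).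
Proof.
move=> dfx.
have de : is_diff (f x : R^o) (expR : R^o -> R^o) ( *:%R^~ (expR (f x))).
  have h : derivable (expR : R^o -> R^o) (f x) 1 by exact: derivable_expR.
  apply: DiffDef; first exact/derivable1_diffP.
  by rewrite deriv1E// derive1E derive_val.
apply: is_diff_eq (is_diff_comp dfx de) _.
by apply/funext => v; rewrite mulrC.
Qed.

End Calculus.

(** * Charts *)

(* All the regularity that vector fields on [TM M] require of its charts. *)
Record c1_atlas (R : realType) (E : normedModType R) (M : chartedSpace E) :
    Prop := C1Atlas {
  c1_chart_at : forall p : M, chart_dom (chart_at p) p;
  c1_mapK : forall (i : atlas M) p, chart_dom i p ->
    chart_inv i (chart_map i p) = p;
  c1_overlap : forall i j : atlas M,
    open (chart_map i @` (chart_dom i `&` chart_dom j));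
  c1_transition : forall (i j : atlas M) p, chart_dom i p -> chart_dom j p ->
    differentiable (chart_map j \o chart_inv i) (chart_map i p) }.

Section C1Atlas.
Context {R : realType} {E : normedModType R} (M : chartedSpace E).
Hypothesis hM : c1_atlas M.
Implicit Types (i j k : atlas M) (p q : M).

Lemma rep_linear i q : linear (rep i q : E -> E).
Proof. exact: linearP. Qed.

Lemma unrep_linear i q : linear (unrep i q : E -> E).
Proof. exact: linearP. Qed.

Lemma near_overlap i j q : chart_dom i q -> chart_dom j q ->
  \forall z \near chart_map i q,
    exists r, [/\ chart_dom i r, chart_dom j r & chart_map i r = z].
Proof.
move=> iq jq; have : open_nbhs (chart_map i q)
    (chart_map i @` (chart_dom i `&` chart_dom j)).
  by split; [exact: c1_overlap|exists q].
by move=> /open_nbhs_nbhs; apply: filterS => z [r [ir jr] <-]; exists r.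
Qed.

(** The chain rule for transition maps. A chart inverse cancels its chart only on the domain, so the
    composite agrees with the direct transition only near q, which suffices for the differential. *)
Lemma diff_transition_comp i j k q v :
  chart_dom i q -> chart_dom j q -> chart_dom k q ->
  'd (chart_map k \o chart_inv j) (chart_map j q)
    ('d (chart_map j \o chart_inv i) (chart_map i q) v) =
  'd (chart_map k \o chart_inv i) (chart_map i q) v.
Proof.
move=> iq jq kq; have dij := c1_transition hM iq jq.
have djk := c1_transition hM jq kq.
have e : (chart_map j \o chart_inv i) (chart_map i q) = chart_map j q.
  by rewrite /= c1_mapK.
have djk' : differentiable (chart_map k \o chart_inv j)
   ((chart_map j \o chart_inv i) (chart_map i q)) by rewrite e.
have dc := differentiable_comp dij djk'.
rewrite (diff_near (f := (chart_map k \o chart_inv j) \o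
    (chart_map j \o chart_inv i)) (g := chart_map k \o chart_inv i) v _ dc).
  by rewrite diff_comp//= c1_mapK.
apply: filterS (near_overlap iq jq) => z [r [ir jr <-]] /=.
by rewrite !c1_mapK.
Qed.

Lemma diff_transition_id i q v : chart_dom i q ->
  'd (chart_map i \o chart_inv i) (chart_map i q) v = v.
Proof.
move=> iq; rewrite (@diff_near _ _ _ id) ?(is_diffE _ (is_diff_id _))//.
by apply: filterS (near_overlap iq iq) => z [r [ir _ <-]]; rewrite /= c1_mapK.
Qed.

Lemma rep_unrep i j q w : chart_dom i q -> chart_dom j q ->
  rep j q (unrep i q w) = 'd (chart_map j \o chart_inv i) (chart_map i q) w.
Proof.
by move=> iq jq; rewrite /rep /unrep diff_transition_comp//; exact: c1_chart_at.
Qed.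

Lemma unrepK i q w : chart_dom i q -> rep i q (unrep i q w) = w.
Proof. by move=> iq; rewrite rep_unrep// diff_transition_id. Qed.

Lemma repK i q v : chart_dom i q -> unrep i q (rep i q v) = v.
Proof.
have jq := c1_chart_at hM q.
by move=> iq; rewrite /rep /unrep diff_transition_comp// diff_transition_id.
Qed.

Lemma rep_at q v : rep (chart_at q) q v = v.
Proof. by rewrite /rep diff_transition_id//; exact: c1_chart_at. Qed.

Lemma unrep_at q v : unrep (chart_at q) q v = v.
Proof. by rewrite /unrep diff_transition_id//; exact: c1_chart_at. Qed.

(** The carrier of M is a bare type, so nearness to q is read in the coordinates of a chart. *)
Definition nearM i q (P : M -> Prop) :=
  \forall z \near chart_map i q, P (chart_inv i z).

Lemma nearM_dom i j q : chart_dom i q -> chart_dom j q ->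
  nearM i q (chart_dom j).
Proof.
move=> iq jq; apply: filterS (near_overlap iq jq) => z [r [ir jr <-]].
by rewrite c1_mapK.
Qed.

Section Dfun.
Context {W : normedModType R}.
Implicit Types f h : M -> W.

Lemma dfun_near q f h v : nearM (chart_at q) q (fun r => f r = h r) ->
  differentiable (f \o chart_inv (chart_at q)) (chart_map (chart_at q) q) ->
  dfun h q v = dfun f q v.
Proof. exact: diff_near. Qed.

End Dfun.
End C1Atlas.

(** * Smooth functions at a point *)

Section Smooth.
Context {R : realType} {E : normedModType R} (M : chartedSpace E).
Hypothesis hM : c1_atlas M.
Implicit Types (i j k : atlas M) (p q : M) (W : normedModType R).

Lemma smooth_at_differentiable W q (f : M -> W) : smooth_at q f ->
  differentiable (f \o chart_inv (chart_at q)) (chart_map (chart_at q) q).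
Proof. by move=> [ O [oO Oq sf]]; exact: (sf [::]). Qed.

Lemma smooth_at_near W q (f h : M -> W) :
  nearM (chart_at q) q (fun r => f r = h r) -> smooth_at q f -> smooth_at q h.
Proof.
rewrite /nearM -nbhs_nearE nbhsE.
move=> [ O' [oO' O'q] fh] [ O [oO Oq /smooth_cdiff sf]].
exists (O `&` O'); split=> //; first exact: openI.
apply/smooth_cdiff => n.
apply: (@cdiff_eq _ _ _ _ _ (f \o chart_inv (chart_at q))).
- exact: openI.
- by move=> z [_ /fh].
- by apply: cdiff_sub (sf n) => z [].
Qed.

Lemma smooth_at_cst W q (a : W) : smooth_at q (cst a : M -> W).
Proof.
exists setT; split=> //; first exact: openT.
by apply/smooth_cdiff => n; exact: (@cdiff_cst _ n E W setT a).
Qed.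

Lemma smooth_at2 W1 W2 W q (f : M -> W1) (h : M -> W2) (F : M -> W) :
  (forall n O, open O -> cdiff n O (f \o chart_inv (chart_at q)) ->
    cdiff n O (h \o chart_inv (chart_at q)) ->
    cdiff n O (F \o chart_inv (chart_at q))) ->
  smooth_at q f -> smooth_at q h -> smooth_at q F.
Proof.
move=> H [ O [oO Oq /smooth_cdiff sf]] [ O' [oO' O'q /smooth_cdiff sh]].
exists (O `&` O'); split=> //; first exact: openI.
apply/smooth_cdiff => n; apply: H; first exact: openI.
  by apply: cdiff_sub (sf n) => z [].
by apply: cdiff_sub (sh n) => z [].
Qed.

Lemma smooth_atD W q (f h : M -> W) : smooth_at q f -> smooth_at q h ->
  smooth_at q (fun r => f r + h r).
Proof. by apply: smooth_at2 => n O oO; exact: cdiffD. Qed.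

Lemma smooth_at_scale W q (f : M -> R^o) (h : M -> W) :
  smooth_at q f -> smooth_at q h -> smooth_at q (fun r => (f r : R) *: h r).
Proof. by apply: smooth_at2 => n O oO; exact: cdiff_scale. Qed.

Lemma smooth_at_coord m q (f : M -> 'rV[R]_m) (l : 'I_m) :
  smooth_at q f -> smooth_at q (fun r => f r 0 l : R^o).
Proof.
by move=> sf; apply: smooth_at2 (sf) (sf) => n O oO cf _; exact: cdiff_coord.
Qed.

End Smooth.

Section Manifold.
Context {R : realType} {m : nat} (M : chartedSpace 'rV[R]_m).
Hypothesis hM : is_manifold M.
Implicit Types (i j k : atlas M) (p q : M) (W : normedModType R).

Lemma manifold_c1 : c1_atlas M.
Proof.
split; [exact: chart_at_dom|exact: chart_mapK|exact: overlap_open|].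
move=> i j p ip jp.
by have st := @transition_smooth _ _ _ hM i j; apply: (st [::]); exists p.
Qed.

(** [smooth_at] refers to the preferred chart; precomposing with a transition map allows any chart
    around q. The preimage of O is open because the transition map is continuous on the overlap. *)
Lemma smooth_at_chart W i q (f : M -> W) (O : set 'rV[R]_m) :
  chart_dom i q -> open O -> O (chart_map i q) ->
  smooth_on O (f \o chart_inv i) -> smooth_at q f.
Proof.
move=> iq oO Oq /smooth_cdiff sf; have jq := c1_chart_at manifold_c1 q.
set j := chart_at q in jq *.
pose A := chart_map j @` (chart_dom j `&` chart_dom i).
have oA : open A by exact: overlap_open.
have st := @transition_smooth _ _ _ hM j i.
have ct : {in A, continuous (chart_map i \o chart_inv j)}.
  move=> z /set_mem Az; apply: differentiable_continuous.
  exact: (st [::] _ Az).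
have oB : open (A `&` (chart_map i \o chart_inv j) @^-1` O).
  by move/(continuous_inP _ oA): ct; apply.
exists (A `&` (chart_map i \o chart_inv j) @^-1` O); split => //.
  split; first by exists q.
  by rewrite /= (chart_mapK hM).
apply/smooth_cdiff => n.
apply: (@cdiff_eq _ _ _ _ _
   ((f \o chart_inv i) \o (chart_map i \o chart_inv j))) => //.
  move=> z [[r [jr ir] <-] _] /=; by rewrite !(chart_mapK hM).
apply: (@cdiff_comp _ _ _ _ _ _ O) => //; first by move=> z [].
apply: (@cdiff_sub _ _ _ _ A); first by move=> z [].
by move/smooth_cdiff: st; apply.
Qed.

(** The components in chart j of a coordinate field of chart i are the derivative along w of the
    transition map. *)
Lemma rep_ext_smooth i j q w : chart_dom i q -> chart_dom j q ->
  smooth_at q (fun r => rep j r (unrep i r w)).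
Proof.
move=> iq jq.
apply: (@smooth_at_chart _ i _ _
  (chart_map i @` (chart_dom i `&` chart_dom j))) => //.
- exact: overlap_open.
- by exists q.
have st := @transition_smooth _ _ _ hM i j.
apply/smooth_cdiff => n; apply: (@cdiff_eq _ _ _ _ _
  ('D_w (chart_map j \o chart_inv i))).
- exact: overlap_open.
- move=> z [r [ir jr] <-] /=; rewrite (chart_mapK hM)//.
  rewrite rep_unrep//; last exact: manifold_c1.
  rewrite deriveE//; exact: c1_transition manifold_c1 _ _ _ ir jr.
by move/smooth_cdiff: st => /(_ n.+1) /cdiffS[].
Qed.

End Manifold.

(** * Connections in a chart *)

Section Connection.
Context {R : realType} {m : nat} (M : chartedSpace 'rV[R]_m).
Hypothesis hM : is_manifold M.
Let hA := manifold_c1 hM.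
Variable nabla : M -> 'rV[R]_m -> (M -> 'rV[R]_m) -> 'rV[R]_m.
Hypothesis hn : is_connection nabla.
Implicit Types (i j : atlas M) (p q : M) (X Y Z : M -> 'rV[R]_m).
Implicit Types (k : R) (a b v x y z c : 'rV[R]_m).

Lemma ext_at p a : ext p a p = a.
Proof. exact: unrep_at hA _ _. Qed.

Lemma ext_linear p q : linear (fun a => ext p a q).
Proof. exact: unrep_linear. Qed.

Lemma ext_smooth p q a : chart_dom (chart_at p) q -> smooth_field_at q (ext p a).
Proof. by move=> pq; apply: rep_ext_smooth => //; exact: c1_chart_at. Qed.

Lemma ext_smooth_at p a : smooth_field_at p (ext p a).
Proof. by apply: ext_smooth; exact: c1_chart_at. Qed.

Lemma smooth_field_near q Y Z : nearM (chart_at q) q (fun r => Y r = Z r) ->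
  smooth_field_at q Y -> smooth_field_at q Z.
Proof.
move=> YZ; apply: smooth_at_near; apply: filterS YZ => z /= -> //.
Qed.

Lemma smooth_fieldD q Y Z : smooth_field_at q Y -> smooth_field_at q Z ->
  smooth_field_at q (fun r => Y r + Z r).
Proof.
move=> sY sZ; rewrite /smooth_field_at.
have -> : (fun r => rep (chart_at q) r (Y r + Z r)) = (fun r =>
    rep (chart_at q) r (Y r) + rep (chart_at q) r (Z r)).
  by apply/funext => r; rewrite /rep linearD.
exact: smooth_atD.
Qed.

Lemma smooth_field_scale q (f : M -> R^o) Y : smooth_at q f ->
  smooth_field_at q Y -> smooth_field_at q (fun r => (f r : R) *: Y r).
Proof.
move=> sf sY; rewrite /smooth_field_at.
have -> : (fun r => rep (chart_at q) r ((f r : R) *: Y r)) = (fun r =>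
    (f r : R) *: rep (chart_at q) r (Y r)).
  by apply/funext => r; rewrite /rep linearZ.
exact: smooth_at_scale.
Qed.

Lemma smooth_field0 q : smooth_field_at q (fun=> 0).
Proof.
rewrite /smooth_field_at.
have -> : (fun r => rep (chart_at q) r 0) = cst 0.
  by apply/funext => r; rewrite /rep linear0.
exact: smooth_at_cst.
Qed.

Lemma smooth_field_sum q n (Y : 'I_n -> M -> 'rV[R]_m) :
  (forall l, smooth_field_at q (Y l)) ->
  smooth_field_at q (fun r => \sum_l Y l r).
Proof.
elim: n Y => [|n IH] Y sY.
  have -> : (fun r => \sum_l Y l r) = fun=> 0.
    by apply/funext => r; rewrite big_ord0.
  exact: smooth_field0.
have -> : (fun r => \sum_l Y l r) =
   (fun r => \sum_(l < n) Y (widen_ord (leqnSn n) l) r + Y ord_max r).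
  by apply/funext => r; rewrite big_ord_recr.
by apply: smooth_fieldD => //; exact: IH.
Qed.

Lemma dfun_cst (W : normedModType R) q (a : W) v : dfun (fun _ : M => a) q v = 0.
Proof. exact: (is_diffE v (is_diff_cst a _)). Qed.

Lemma nabla_scale q v k Y : smooth_field_at q Y ->
  nabla q v (fun r => k *: Y r) = k *: nabla q v Y.
Proof.
move=> sY; have /= -> := nabla_leibniz hn v (smooth_at_cst q (k : R^o)) sY.
by rewrite [dfun _ _ _]dfun_cst scale0r add0r.
Qed.

Lemma nabla0 q v : nabla q v (fun=> 0) = 0.
Proof.
have := nabla_scale v 0 (smooth_field0 q).
by rewrite !scale0r.
Qed.

Lemma nabla_sum q v n (Y : 'I_n -> M -> 'rV[R]_m) :
  (forall l, smooth_field_at q (Y l)) ->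
  nabla q v (fun r => \sum_l Y l r) = \sum_l nabla q v (Y l).
Proof.
elim: n Y => [|n IH] Y sY.
  have -> : (fun r => \sum_l Y l r) = fun=> 0.
    by apply/funext => r; rewrite big_ord0.
  by rewrite nabla0 big_ord0.
have -> : (fun r => \sum_l Y l r) =
   (fun r => \sum_(l < n) Y (widen_ord (leqnSn n) l) r + Y ord_max r).
  by apply/funext => r; rewrite big_ord_recr.
rewrite (nabla_add hn)//; last exact: smooth_field_sum.
by rewrite IH// big_ord_recr.
Qed.

(* The Leibniz rule only asks f to be smooth at q, so f may be taken to be the
   indicator of a neighbourhood of q on which Y and Z agree. *)
Lemma nabla_local q v Y Z : smooth_field_at q Y ->
  nearM (chart_at q) q (fun r => Y r = Z r) -> nabla q v Y = nabla q v Z.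
Proof.
move=> sY YZ; have sZ := smooth_field_near YZ sY.
have jq := c1_chart_at hA q; set j := chart_at q in jq YZ.
move: YZ; rewrite /nearM -nbhs_nearE nbhsE => - [ A [oA Aq] AYZ].
pose f r : R^o := if `[< chart_dom j r /\ A (chart_map j r) >] then 1 else 0.
have f1 : nearM j q (fun r => (cst 1 : M -> R^o) r = f r).
  have nA : \forall z \near chart_map j q, A z by exact: open_nbhs_nbhs.
  apply: filterS2 nA (near_overlap hA jq jq) => z Az [r [jr _ rz]].
  by rewrite /f -rz c1_mapK// asboolT// rz.
have sf : smooth_at q f by apply: smooth_at_near f1 _; exact: smooth_at_cst.
have fq : f q = 1 by rewrite /f asboolT.
have df : dfun f q v = 0.
  rewrite (dfun_near v f1); first exact: dfun_cst.
  by apply: smooth_at_differentiable; exact: smooth_at_cst.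
have E : (fun r => (f r : R) *: Y r) = (fun r => (f r : R) *: Z r).
  apply/funext => r; rewrite /f; case: asboolP => [[jr Ar]|_].
    by have /= := AYZ _ Ar; rewrite c1_mapK// => ->.
  by rewrite !scale0r.
have := nabla_leibniz hn v sf sY; rewrite E (nabla_leibniz hn v sf sZ).
by rewrite df fq !scale0r !add0r !scale1r => ->.
Qed.

Lemma nabla_linearl q Y : smooth_field_at q Y -> linear (fun v => nabla q v Y).
Proof. by move=> sY k a b; exact: nabla_linear. Qed.

Lemma nabla_linearr p q v : chart_dom (chart_at p) q ->
  linear (fun a => nabla q v (ext p a)).
Proof.
move=> pq k a b.
have -> : ext p (k *: a + b) = (fun r => k *: ext p a r + ext p b r).
  by apply/funext => r; rewrite ext_linear.
have sa := ext_smooth a pq; have sb := ext_smooth b pq.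
rewrite (nabla_add hn)//; first by rewrite nabla_scale.
by apply: (smooth_field_scale (f := cst k)) => //; exact: smooth_at_cst.
Qed.

(** The local formula v(Y^l) e_l + Gamma(v, Y): near q, Y is a combination of the coordinate fields
    e_l with smooth coefficients, and the Leibniz rule applies to each term. *)
Lemma nabla_expand q v Y : smooth_field_at q Y ->
  nabla q v Y = dfun (fun r => rep (chart_at q) r (Y r)) q v +
    nabla q v (ext q (Y q)).
Proof.
move=> sY; have jq := c1_chart_at hA q.
pose y r := rep (chart_at q) r (Y r).
have dy := smooth_at_differentiable sY.
pose e l := delta_mx 0 l : 'rV[R]_m.
have sy l : smooth_at q (fun r => y r 0 l : R^o) by exact: smooth_at_coord.
have sye l : smooth_field_at q (fun r => y r 0 l *: ext q (e l) r).
  by apply: smooth_field_scale => //; exact: ext_smooth_at.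
(* The expansion is only valid on the chart domain, hence the appeal to locality. *)
rewrite (@nabla_local _ _ _ (fun r => \sum_l y r 0 l *: ext q (e l) r))//.
  rewrite nabla_sum//.
  rewrite (linear_rowE (Y q) (nabla_linearr v jq)) (row_sum_delta (dfun _ _ _)).
  rewrite -big_split/=; apply: eq_bigr => l _.
  have /= -> := nabla_leibniz hn v (sy l) (ext_smooth_at q (e l)).
  rewrite ext_at /y rep_at//; congr (_ *: _ + _).
  exact: (is_diffE v (is_diff_coord l (differentiableP dy))).
apply: filterS (nearM_dom hA jq jq) => z jz.
rewrite -[LHS](repK hA _ jz).
exact: (linear_rowE (y z) (ext_linear q z)).
Qed.

(* Christoffel symbols of the chart [chart_at p], at the point with coordinates
   c *)
Definition chris p c x y :=
  rep (chart_at p) (chart_inv (chart_at p) c)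
    (nabla (chart_inv (chart_at p) c) (ext p x (chart_inv (chart_at p) c))
       (ext p y)).

Lemma near_chart_dom p : \forall c \near chart_map (chart_at p) p,
  chart_dom (chart_at p) (chart_inv (chart_at p) c).
Proof.
by have jp := c1_chart_at hA p; have := nearM_dom hA jp jp.
Qed.

Lemma chris_linearl p c y :
  chart_dom (chart_at p) (chart_inv (chart_at p) c) ->
  linear (fun x => chris p c x y).
Proof.
move=> pc k a b; rewrite /chris ext_linear nabla_linearl; last exact: ext_smooth.
exact: rep_linear.
Qed.

Lemma chris_linearr p c x :
  chart_dom (chart_at p) (chart_inv (chart_at p) c) -> linear (chris p c x).
Proof.
move=> pc k a b; rewrite /chris nabla_linearr//; exact: rep_linear.
Qed.

Lemma chris_at p x y : chris p (chart_map (chart_at p) p) x y =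
  nabla p x (ext p y).
Proof.
by rewrite /chris c1_mapK ?rep_at ?ext_at//; exact: c1_chart_at.
Qed.

Lemma chris_differentiable p x y :
  differentiable (fun c => chris p c x y) (chart_map (chart_at p) p).
Proof.
have := nabla_smooth hn (ext_smooth_at p x) (ext_smooth_at p y).
exact: smooth_at_differentiable.
Qed.

(** The derivative of the Christoffel map along v, which is the first-order part of the
    curvature. *)
Definition dchris p v x y :=
  'd (fun c => chris p c x y) (chart_map (chart_at p) p) v.

Lemma dchris_linear p x y : linear (fun v => dchris p v x y).
Proof. exact: linearP. Qed.

Lemma dchris_linearl p v y : linear (fun x => dchris p v x y).
Proof.
move=> k a b; have da := differentiableP (chris_differentiable p a y).
have db := differentiableP (chris_differentiable p b y).
have := is_diffD (is_diffZ k da) db.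
move=> dab; apply: (is_diffE v (is_diff_near _ dab)).
apply: filterS (near_chart_dom p) => c pc.
exact: esym (chris_linearl y pc k a b).
Qed.

Lemma lie_ext p x y : lie (ext p x) (ext p y) p = 0.
Proof.
suff H a v : dfun (fun q => rep (chart_at p) q (ext p a q)) p v = 0.
  by rewrite /lie !H subrr.
have jp := c1_chart_at hA p.
rewrite (@dfun_near _ _ _ _ _ (fun=> a)); first exact: dfun_cst.
  apply: filterS (nearM_dom hA jp jp) => z jz.
  by rewrite /ext unrepK.
exact: differentiable_cst.
Qed.

Lemma torsion_chris p x y : torsion nabla p x y =
  nabla p x (ext p y) - nabla p y (ext p x).
Proof. by rewrite /torsion /torsion_fields lie_ext !ext_at subr0. Qed.

(** The bracket of coordinate fields vanishes, and [nabla_expand] splits each second covariant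
    derivative into a derivative of Gamma and a term quadratic in Gamma. *)
Lemma curvature_chris p x y z : curvature nabla p x y z =
  dchris p x y z + nabla p x (ext p (nabla p y (ext p z))) -
  (dchris p y x z + nabla p y (ext p (nabla p x (ext p z)))).
Proof.
have s a b : smooth_field_at p (fun q => nabla q (ext p a q) (ext p b)).
  by apply: (nabla_smooth hn); exact: ext_smooth_at.
have [l0 _ _ _ _] := linearPE (nabla_linearl (ext_smooth_at p z)).
rewrite /curvature /curvature_fields lie_ext !ext_at l0 subr0.
by rewrite (nabla_expand x (s y z)) (nabla_expand y (s x z)) !ext_at.
Qed.

Section Metric.
Variable g : M -> 'rV[R]_m -> 'rV[R]_m -> R.
Hypotheses (hg : is_riemannian g) (hgn : is_metric_for g nabla).

(** The bilinear form of g in the chart at p, at the point with coordinates c. *)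
Definition gloc p c x y : R^o := let q := chart_inv (chart_at p) c in
  g q (ext p x q) (ext p y q).

Lemma riem_linearl q y : linear (fun x => g q x y : R^o).
Proof. by move=> k a b; rewrite riem_linear. Qed.

Lemma riem_linearr q x : linear (fun y => g q x y : R^o).
Proof. by move=> k a b; rewrite riem_sym// riem_linear// !(riem_sym hg _ x). Qed.

Lemma gloc_linearl p c y : linear (fun x => gloc p c x y).
Proof. by move=> k a b; rewrite /gloc ext_linear riem_linearl. Qed.

Lemma gloc_linearr p c x : linear (gloc p c x).
Proof. by move=> k a b; rewrite /gloc ext_linear riem_linearr. Qed.

Lemma gloc_differentiable p x y :
  differentiable (fun c => gloc p c x y) (chart_map (chart_at p) p).
Proof.
have := riem_smooth hg (ext_smooth_at p x) (ext_smooth_at p y).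
exact: smooth_at_differentiable.
Qed.

Lemma gloc_diff p x y v :
  'd (fun c => gloc p c x y) (chart_map (chart_at p) p) v =
  g p (nabla p v (ext p x)) y + g p x (nabla p v (ext p y)).
Proof.
have := hgn v (ext_smooth_at p x) (ext_smooth_at p y).
by rewrite !ext_at.
Qed.

End Metric.
End Connection.

(** * The tangent bundle *)

Section Tangent.
Context {R : realType} {m : nat} (M : chartedSpace 'rV[R]_m).
Hypothesis hM : is_manifold M.
Let hA := manifold_c1 hM.
Local Notation E := 'rV[R]_m.
Local Notation N := (TM M).
Implicit Types (i j : atlas M) (p q : M) (u : N) (w X Y Z : (E * E)%type).
Implicit Types (a b v x y c : E).

Lemma TM_transition i j (z : E * E) q : chart_dom i q -> chart_dom j q ->
  chart_map i q = z.1 ->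
  (chart_map (j : atlas N) \o chart_inv (i : atlas N)) z =
  ((chart_map j \o chart_inv i) z.1,
    'd (chart_map j \o chart_inv i) (z.1) z.2).
Proof.
case: z => z1 z2 iq jq /= <-; rewrite !(c1_mapK hA)//; congr (_, _).
exact: rep_unrep.
Qed.

Lemma TM_overlap i j : open (chart_map (i : atlas N) @`
  (chart_dom (i : atlas N) `&` chart_dom (j : atlas N))).
Proof.
have -> : chart_map (i : atlas N) @`
    (chart_dom (i : atlas N) `&` chart_dom (j : atlas N)) =
   fst @^-1` (chart_map i @` (chart_dom i `&` chart_dom j)).
  apply/seteqP; split=> [z [[q v] [iq jq] <-]|[z1 z2] [q [iq jq] /= qz]].
    by exists q.
  exists (q, unrep i q z2) => //=.
  by rewrite unrepK// qz.
apply: open_comp; last exact: c1_overlap.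
move=> z _; apply: differentiable_continuous.
by have [] := is_diff_fst z.
Qed.

(** The fibre component of the transition map is dT(z.1) z.2, a family of linear maps. For a fixed
    vector a it is the directional derivative of T along a, differentiable because T is smooth, and
    [is_diff_linfam] does the rest. *)
Lemma TM_transition_differentiable i j u : chart_dom i u.1 -> chart_dom j u.1 ->
  differentiable (chart_map (j : atlas N) \o chart_inv (i : atlas N))
    (chart_map (i : atlas N) u).
Proof.
move=> iu ju; set T := chart_map j \o chart_inv i.
set z0 := chart_map (i : atlas N) u.
have dT c : (exists r, [/\ chart_dom i r, chart_dom j r & chart_map i r = c]) ->
    differentiable T c.
  by move=> [r [ir jr <-]]; exact: c1_transition hA _ _ _ ir jr.
have nT := near_fst (z := z0) (near_overlap hA iu ju).
apply: (@differentiable_near _ _ _ (fun z : E * E => (T z.1, 'd T (z.1) z.2))).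
  apply: filterS nT => z [r [ir jr rz]].
  by rewrite (TM_transition ir jr).
have f1 : differentiable (fst : E * E -> E) z0 by have [] := is_diff_fst z0.
apply: differentiable_pair.
  by apply: (differentiable_comp f1); apply: dT; exists u.1; split.
have H a : differentiable (fun z : E * E => 'd T (z.1) a) z0.
  apply: (@differentiable_near _ _ _ ('D_a T \o fst)).
    by apply: filterS nT => z /dT dTz; rewrite /= deriveE.
  apply: (differentiable_comp f1).
  by apply: (@transition_smooth _ _ _ hM i j [:: a]); exists u.1.
have Ll : \forall z \near z0, linear ('d T (z.1) : E -> E).
  by near=> z; exact: linearP.
by have [] := is_diff_linfam Ll H (is_diff_snd z0).
Unshelve. all: by end_near. Qed.

Lemma TM_c1 : c1_atlas N.
Proof.
split.
- by move=> u; exact: c1_chart_at hA u.1.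
- move=> i [q v] /= iq; rewrite (c1_mapK hA)//; congr (_, _).
  exact: repK.
- exact: TM_overlap.
- exact: TM_transition_differentiable.
Qed.

Lemma near_TM i j u : chart_dom i u.1 -> chart_dom j u.1 ->
  \forall z \near chart_map (i : atlas N) u,
    exists q : N, [/\ chart_dom i q.1, chart_dom j q.1 &
     chart_map (i : atlas N) q = z].
Proof. by move=> iu ju; have := near_overlap TM_c1 (q := u) iu ju. Qed.

Lemma dfun_comp_proj (W : normedModType R) (f : M -> W) u :
  differentiable (f \o chart_inv (chart_at u.1))
    (chart_map (chart_at u.1) u.1) ->
  is_diff (chart_map (chart_at u) u)
    ((fun u' : N => f u'.1) \o chart_inv (chart_at u))
    (fun w => dfun f u.1 w.1).
Proof.
move=> df; pose z0 := chart_map (chart_at u) u.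
have H : is_diff (z0.1) (f \o chart_inv (chart_at u.1)) (dfun f u.1).
  exact: differentiableP.
exact: (is_diff_comp (is_diff_fst z0) H).
Qed.

(** The preferred chart of TM at u is induced by the preferred chart at the base point, and in these
    charts the projection is [fst]. *)
Lemma dprojE u w : dproj u w = w.1.
Proof.
have iu := c1_chart_at hA u.1.
rewrite /dproj /tmap (diff_near (f := fst)).
- exact: (is_diffE w (is_diff_fst _)).
- apply: filterS (near_TM iu iu) => z [q [iq _ <-]] /=.
  by rewrite (c1_mapK hA).
- by have [] := is_diff_fst (chart_map (chart_at u) u).
Qed.

Lemma rep_TM1 i u w : chart_dom i u.1 ->
  (rep (i : atlas N) u w).1 = rep i u.1 w.1.
Proof.
move=> iu; have ju := c1_chart_at hA u.1.
have dT := c1_transition TM_c1 (p := u) ju iu.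
have e := is_diffE w (is_diff_comp (differentiableP dT) (is_diff_fst _)).
rewrite /rep -[LHS]e.
have H : differentiable (chart_map i \o chart_inv (chart_at u.1))
   (chart_map (chart_at u) u).1 by exact: c1_transition.
have e' := is_diffE w (is_diff_comp (is_diff_fst _) (differentiableP H)).
by rewrite -[RHS]e'.
Qed.

Lemma rep_TM2 i u w : chart_dom i u.1 ->
  (rep (i : atlas N) u w).2 = dfun (fun u' : N => rep i u'.1 u'.2) u w.
Proof.
move=> iu; have ju := c1_chart_at hA u.1.
have dT := c1_transition TM_c1 (p := u) ju iu.
have e := is_diffE w (is_diff_comp (differentiableP dT) (is_diff_snd _)).
exact: esym e.
Qed.

Lemma vliftE u a : vlift u a = (0, a).
Proof.
have H : is_diff (0 : R^o)
   (fun t : R^o => chart_map (chart_at u) ((u.1, u.2 + (t : R) *: a) : N))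
   (fun t => (0, 0 + t *: a)).
  have -> : (fun t : R^o =>
      chart_map (chart_at u) ((u.1, u.2 + (t : R) *: a) : N)) =
     (fun t => (chart_map (chart_at u.1) u.1, (u.2 : E) + (t : R) *: a)).
    by apply/funext => t /=; rewrite (rep_at hA).
  exact: (is_diff_pair (is_diff_cst _ _)
    (is_diffD (is_diff_cst u.2 _) (is_diff_scalel _ _))).
by rewrite /vlift (derive_diff (1 : R^o) H) add0r scale1r.
Qed.

Section Connection.
Variable nabla : M -> E -> (M -> E) -> E.
Hypothesis hn : is_connection nabla.

Definition vertical_part u X : E := X.2 + nabla u.1 X.1 (ext u.1 u.2).

Lemma nablas_xi u w : nablas nabla u w (@xi _ _ M) = vertical_part u w.
Proof.
rewrite /nablas /pullback -/(dproj u w) dprojE; congr (_ + _).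
have iu := c1_chart_at hA u.1.
rewrite /bundle_proj /xi -rep_TM2//.
by have -> := rep_at TM_c1 u w.
Qed.

Lemma vertical_part_linear u : linear (vertical_part u).
Proof.
move=> k X Y; rewrite /vertical_part /=.
rewrite (nabla_linearl hn); last exact: ext_smooth_at.
by rewrite scalerDr addrACA.
Qed.

Lemma horizontalE u w : horizontal nabla u w <->
  w.2 = - nabla u.1 w.1 (ext u.1 u.2).
Proof.
rewrite /horizontal nablas_xi /vertical_part; split=> [/eqP|->].
  by rewrite addr_eq0 => /eqP.
by rewrite addNr.
Qed.

Lemma hliftE u a : hlift nabla u a = (a, - nabla u.1 a (ext u.1 u.2)).
Proof.
apply: xget_unique; first by split; [exact/horizontalE|exact: dprojE].
by move=> [w1 w2] [/horizontalE/= -> ]; rewrite dprojE/= => ->.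
Qed.

Lemma vpartE u X : vpart nabla u X = (0, vertical_part u X).
Proof.
rewrite /vpart /hpart hliftE dprojE; case: X => X1 X2.
by rewrite -[LHS]/(X1 - X1, X2 - - nabla u.1 X1 (ext u.1 u.2)) subrr opprK.
Qed.

Lemma vcompE u X : vcomp nabla u X = vertical_part u X.
Proof.
apply: xget_unique; first by rewrite /= vliftE vpartE.
by move=> a; rewrite /= vliftE vpartE => -[].
Qed.

Lemma nablas_chart p u w (s : N -> E) : chart_dom (chart_at p) u.1 ->
  differentiable ((fun u' => rep (chart_at p) u'.1 (s u')) \o
    chart_inv (chart_at u)) (chart_map (chart_at u) u) ->
  nablas nabla u w s =
    unrep (chart_at p) u.1 (dfun (fun u' => rep (chart_at p) u'.1 (s u')) u w)
    + nabla u.1 w.1 (ext p (rep (chart_at p) u.1 (s u))).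
Proof.
move=> iu ds; have ju := c1_chart_at hA u.1.
set i := chart_at p in iu ds *; set j := chart_at u.1 in ju.
set s' := fun u' => rep i u'.1 (s u') in ds *.
have es (q : N) : chart_dom i q.1 -> s q = ext p (s' q) q.1.
  by move=> iq; rewrite /s' /ext repK.
have se := ext_smooth hM (s' u) iu.
rewrite /nablas /pullback -/(dproj u w) dprojE (nabla_expand hM hn _ se).
rewrite /bundle_proj -es// addrA; congr (_ + _).
pose L (z : E * E) a := rep j (chart_inv j z.1) (ext p a (chart_inv j z.1)).
have Ll : \forall z \near chart_map (chart_at u) u, linear (L z).
  by near=> z => k a b; rewrite /L ext_linear; exact: rep_linear.
have sL a : smooth_field_at u.1 (ext p a) by exact: ext_smooth.
have Ld a := dfun_comp_proj (smooth_at_differentiable (sL a)).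
have := is_diff_linfam Ll (fun a => @ex_diff _ _ _ _ _ _ _ (Ld a))
  (differentiableP ds).
have Ls : \forall z \near chart_map (chart_at u) u,
   L z ((s' \o chart_inv (chart_at u)) z) =
   ((fun u' : N => rep j u'.1 (s u')) \o chart_inv (chart_at u)) z.
  apply: filterS (near_TM ju iu) => z [q [jq iq <-]].
  have /= -> := c1_mapK TM_c1 (p := q) jq.
  by rewrite /L /= (c1_mapK hA)// -es.
move=> /(is_diff_near Ls) /(is_diffE w) H.
have e : (s' \o chart_inv (chart_at u)) (chart_map (chart_at u) u) = s' u.
  by have /= -> := c1_mapK TM_c1 (p := u) ju.
have H2 : 'd (L^~ (s' u)) (chart_map (chart_at u) u) w =
    dfun (fun q => rep j q (ext p (s' u) q)) u.1 w.1.
  exact: (is_diffE w (Ld (s' u))).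
rewrite e in H.
have {}H := etrans H (congr1 (+%R^~ _) H2).
transitivity ('d ((fun u' => rep j u'.1 (s u')) \o chart_inv (chart_at u))
  (chart_map (chart_at u) u) w) => //.
rewrite H addrC; congr (_ + _).
have Lu a : L (chart_map (chart_at u) u) a = unrep i u.1 a.
  by rewrite /L /= (c1_mapK hA)// (rep_at hA).
exact: Lu.
Unshelve. all: by end_near. Qed.

(** [vertical_part] at each point refers to that point's own chart. Seen as nabla^*_w xi, which
    [nablas_chart] computes in other charts, it is brought into one fixed chart in which it can be
    differentiated. *)
Lemma vertical_part_chart p u w : chart_dom (chart_at p) u.1 ->
  rep (chart_at p) u.1 (vertical_part u w) =
  (rep (chart_at p : atlas N) u w).2 +
   rep (chart_at p) u.1 (nabla u.1 w.1 (ext p (rep (chart_at p) u.1 u.2))).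
Proof.
move=> iu; have ju := c1_chart_at hA u.1.
rewrite -nablas_xi (nablas_chart (p := p))//.
  have [_ rD _ _ _] := linearPE (rep_linear (chart_at p) u.1).
  by rewrite rD (unrepK hA)//; congr (_ + _); exact: esym (rep_TM2 w iu).
have dT := c1_transition TM_c1 (p := u) ju iu.
by have [] := is_diff_comp (differentiableP dT) (is_diff_snd _).
Qed.

End Connection.
End Tangent.

(** * Differentiation of sections of the pull-back bundle *)

Section Sections.
Context {R : realType} {m : nat} (M : chartedSpace 'rV[R]_m).
Hypothesis hM : is_manifold M.
Let hA := manifold_c1 hM.
Local Notation E := 'rV[R]_m.
Local Notation N := (TM M).
Variable nabla : M -> E -> (M -> E) -> E.
Hypothesis hn : is_connection nabla.
Implicit Types (p q : M) (u : N) (w : (E * E)%type) (X Y Z : N -> (E * E)%type).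
Implicit Types (a b v x y c : E).

(** A derivative of components in the fixed chart at u, hence dependent on the chart; its skew part
    is the Lie bracket. *)
Definition dfield u Y w : (E * E)%type :=
  dfun (fun u' => rep (chart_at u) u' (Y u')) u w.

(* A section of pi^*TM as a function of the coordinates z, with components in
   the one chart at [u.1]. *)
Definition section_rep u (s : N -> E) (z : E * E) : E :=
  rep (chart_at u.1) (chart_inv (chart_at u) z).1
    (s (chart_inv (chart_at u) z)).

Lemma lie_dfield1 u X Y :
  (lie X Y u).1 = (dfield u Y (X u)).1 - (dfield u X (Y u)).1.
Proof. by rewrite /lie /dfield. Qed.

Lemma lie_dfield2 u X Y :
  (lie X Y u).2 = (dfield u Y (X u)).2 - (dfield u X (Y u)).2.
Proof. by rewrite /lie /dfield. Qed.

Lemma is_diff_field u Y : smooth_field_at u Y ->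
  is_diff (chart_map (chart_at u) u)
    ((fun u' => rep (chart_at u) u' (Y u')) \o chart_inv (chart_at u)) (dfield u Y).
Proof. by move=> /smooth_at_differentiable dY; exact: differentiableP. Qed.

(** Coordinates near those of u come from points of TM, and the equations offered to the hypothesis
    are the rewrite rules back to these points. *)
Lemma near_at u (P : (E * E)%type -> Prop) :
  (forall (u' : N) z, chart_dom (chart_at u.1) u'.1 ->
    chart_inv (chart_at u) z = u' -> chart_inv (chart_at u.1) z.1 = u'.1 ->
    z.2 = rep (chart_at u.1) u'.1 u'.2 -> P z) ->
  \forall z \near chart_map (chart_at u) u, P z.
Proof.
move=> H; have iu := c1_chart_at hA u.1.
apply: filterS (near_TM hM iu iu) => z [q [iq _ <-]]; apply: (H q) => //.
  exact: (c1_mapK (TM_c1 hM) (p := q)).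
exact: (c1_mapK hA (p := q.1)).
Qed.

Lemma chart_map_at u : chart_map (chart_at u) u =
  (chart_map (chart_at u.1) u.1, u.2).
Proof. by rewrite /= (rep_at hA). Qed.

Lemma section_rep_at u s : section_rep u s (chart_map (chart_at u) u) = s u.
Proof.
have := c1_mapK (TM_c1 hM) (p := u) (c1_chart_at (TM_c1 hM) u).
by rewrite /section_rep => ->; exact: rep_at.
Qed.

Lemma is_diff_dproj u Y : smooth_field_at u Y ->
  is_diff (chart_map (chart_at u) u)
    (section_rep u (fun u' => dproj u' (Y u'))) (fun w => (dfield u Y w).1).
Proof.
move=> /is_diff_field dY.
have := is_diff_comp dY (is_diff_fst _); apply: is_diff_near.
apply: near_at => u' z iu' zu' _ _; rewrite /section_rep /comp zu'.
by rewrite (dprojE hM) (rep_TM1 hM).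
Qed.

Lemma nablas_sectionE u w (s : N -> E) ds :
  is_diff (chart_map (chart_at u) u) (section_rep u s) ds ->
  nablas nabla u w s = ds w + nabla u.1 w.1 (ext u.1 (s u)).
Proof.
move=> dss; rewrite /nablas /pullback -/(dproj u w) (dprojE hM).
by congr (_ + _); exact: (is_diffE w dss).
Qed.

(** In the chart at u the vertical part at coordinates (c, v) is Y.2 + Gamma_c(Y.1, v). The three
    Gamma terms are the derivatives in c, in Y.1 and in v, the last along w.2 because v is itself a
    coordinate. *)
Lemma is_diff_vcomp u Y : smooth_field_at u Y ->
  is_diff (chart_map (chart_at u) u)
    (section_rep u (fun u' => vcomp nabla u' (Y u')))
    (fun w => (dfield u Y w).2 +
      (dchris nabla u.1 w.1 (Y u).1 u.2 +
       nabla u.1 (dfield u Y w).1 (ext u.1 u.2) +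
       nabla u.1 (Y u).1 (ext u.1 w.2))).
Proof.
move=> dY; have z0 := chart_map_at u.
have df := is_diff_field dY.
have d1 := is_diff_comp df (is_diff_fst _).
have d2 := is_diff_comp df (is_diff_snd _).
set F := (fun u' => rep (chart_at u) u' (Y u')) \o _ in df d1 d2.
have F0 : F (chart_map (chart_at u) u) = Y u.
  rewrite /F /comp (c1_mapK (TM_c1 hM)); last exact: c1_chart_at (TM_c1 hM) _.
  exact: rep_at (TM_c1 hM) _ _.
pose B (z : E * E) a b := chris nabla u.1 z.1 a b.
have nd : \forall z \near chart_map (chart_at u) u,
   chart_dom (chart_at u.1) (chart_inv (chart_at u.1) z.1).
  by apply: near_at => u' z iu' _ -> _.
have Bl : \forall z \near chart_map (chart_at u) u, forall b, linear ((B z)^~ b).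
  by apply: filterS nd => z nz b; exact: (chris_linearl hM hn).
have Br : \forall z \near chart_map (chart_at u) u, forall a, linear (B z a).
  by apply: filterS nd => z nz a; exact: (chris_linearr hM hn).
have Bd a b : is_diff (chart_map (chart_at u) u) (fun z => B z a b)
   (fun w => 'd (fun c => chris nabla u.1 c a b)
      (chart_map (chart_at u.1) u.1) w.1).
  have := differentiableP (chris_differentiable hM hn u.1 a b).
  exact: (is_diff_comp (is_diff_fst (chart_map (chart_at u) u))).
have := is_diffD d2 (is_diff_bilinfam Bl Br
  (fun a b => @ex_diff _ _ _ _ _ _ _ (Bd a b)) d1
  (is_diff_snd (chart_map (chart_at u) u))).
set zu := chart_map (chart_at u) u in z0 F0 nd Bl Br Bd df d1 d2 *.
move=> dB.
have z02 : zu.2 = u.2 by rewrite z0.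
have Bat a b : B zu a b = nabla u.1 a (ext u.1 b).
  by rewrite /B z0; exact: chris_at.
have dG : is_diff zu (fun z => (F z).2 + B z (F z).1 z.2) (fun w =>
   (dfield u Y w).2 + ('d (fun z => B z (F zu).1 zu.2) zu w +
      B zu (dfield u Y w).1 zu.2 + B zu (F zu).1 w.2)) by exact: dB.
have eG : (fun w => (dfield u Y w).2 + ('d (fun z => B z (F zu).1 zu.2) zu w +
      B zu (dfield u Y w).1 zu.2 + B zu (F zu).1 w.2)) =
   (fun w => (dfield u Y w).2 +
      (dchris nabla u.1 w.1 (Y u).1 u.2 +
       nabla u.1 (dfield u Y w).1 (ext u.1 u.2) +
       nabla u.1 (Y u).1 (ext u.1 w.2))).
  apply/funext => w; rewrite F0 z02 !Bat; congr (_ + (_ + _ + _)).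
  exact: (is_diffE w (Bd _ _)).
rewrite -eG; apply: is_diff_near dG.
apply: near_at => u' z iu' zu' z1 z2; rewrite /section_rep /B /chris z1 zu' z2.
rewrite (vcompE hM) (vertical_part_chart hM hn)// /F /comp zu' -/(chart_at u).
congr (_ + _); rewrite rep_TM1// /ext (repK hA)//.
Qed.

Section Metric.
Variable g : M -> E -> E -> R.
Hypotheses (hg : is_riemannian g) (hgn : is_metric_for g nabla).

(** The product rule for nabla^*. The derivative of the coefficients of g splits by metric
    compatibility on coordinate fields, and each half completes one derivative of components to
    nabla^*. *)
Lemma is_diff_metric u (s t : N -> E) ds dt :
  is_diff (chart_map (chart_at u) u) (section_rep u s) ds ->
  is_diff (chart_map (chart_at u) u) (section_rep u t) dt ->
  is_diff (chart_map (chart_at u) u)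
    ((fun u' : N => g u'.1 (s u') (t u') : R^o) \o chart_inv (chart_at u))
    (fun w => g u.1 (nablas nabla u w s) (t u) +
              g u.1 (s u) (nablas nabla u w t)).
Proof.
move=> dss dtt; have z0 := chart_map_at u.
have s0 := section_rep_at u s; have t0 := section_rep_at u t.
pose B (z : E * E) a b := gloc g u.1 z.1 a b.
have Bl : \forall z \near chart_map (chart_at u) u, forall b, linear ((B z)^~ b).
  by near=> z => b; exact: gloc_linearl.
have Br : \forall z \near chart_map (chart_at u) u, forall a, linear (B z a).
  by near=> z => a; exact: gloc_linearr.
have Bd a b : is_diff (chart_map (chart_at u) u) (fun z => B z a b)
   (fun w => 'd (fun c => gloc g u.1 c a b)
      (chart_map (chart_at u.1) u.1) w.1).
  have := differentiableP (gloc_differentiable hM hg u.1 a b).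
  exact: (is_diff_comp (is_diff_fst (chart_map (chart_at u) u))).
have dB := is_diff_bilinfam Bl Br
  (fun a b => @ex_diff _ _ _ _ _ _ _ (Bd a b)) dss dtt.
set zu := chart_map (chart_at u) u in z0 s0 t0 Bl Br Bd dss dtt dB *.
have Bat a b : B zu a b = g u.1 a b.
  rewrite /B z0 /gloc /= (c1_mapK hA); last exact: c1_chart_at hA _.
  by rewrite !(ext_at hM).
have eG : (fun w => 'd (fun z => B z (section_rep u s zu) (section_rep u t zu)) zu w
      + B zu (ds w) (section_rep u t zu) + B zu (section_rep u s zu) (dt w)) =
   (fun w => g u.1 (nablas nabla u w s) (t u) +
              g u.1 (s u) (nablas nabla u w t)).
  apply/funext => w; rewrite s0 t0 !Bat.
  rewrite (nablas_sectionE w dss) (nablas_sectionE w dtt).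
  have [_ gDl _ _ _] := linearPE (riem_linearl hg u.1 (t u)).
  have [_ gDr _ _ _] := linearPE (riem_linearr hg u.1 (s u)).
  rewrite gDl gDr.
  have e := etrans (is_diffE w (Bd (s u) (t u)))
     (gloc_diff hM hgn u.1 (s u) (t u) w.1).
  transitivity (g u.1 (nabla u.1 w.1 (ext u.1 (s u))) (t u) +
     g u.1 (s u) (nabla u.1 w.1 (ext u.1 (t u))) +
     g u.1 (ds w) (t u) + g u.1 (s u) (dt w)).
    by congr (_ + _ + _); exact: e.
  by rewrite -addrA [LHS]addrC addrACA.
rewrite -eG; apply: is_diff_near dB.
apply: near_at => u' z iu' zu' z1 z2; rewrite /section_rep /B /gloc z1 /comp zu'.
by rewrite /ext !(repK hA).
Unshelve. all: by end_near. Qed.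

End Metric.
End Sections.

(** * The Levi-Civita connection of the weighted Sasaki metric *)

Section SasakiConnection.
Context {R : realType} {m : nat} (M : chartedSpace 'rV[R]_m).
Hypothesis hM : is_manifold M.
Let hA := manifold_c1 hM.
Local Notation E := 'rV[R]_m.
Local Notation N := (TM M).
Variable g : M -> E -> E -> R.
Hypothesis hg : is_riemannian g.
Variable nabla : M -> E -> (M -> E) -> E.
Hypothesis hn : is_connection nabla.
Hypothesis hgn : is_metric_for g nabla.
Implicit Types (p q : M) (u : N) (w : (E * E)%type).
Implicit Types (a b v x y z c : E).

Lemma riemDl p a b z : g p (a + b) z = g p a z + g p b z.
Proof. by have [_ h _ _ _] := linearPE (riem_linearl hg p z). Qed.
Lemma riemZl p k a z : g p (k *: a) z = k * g p a z.
Proof. by have [_ _ h _ _] := linearPE (riem_linearl hg p z). Qed.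
Lemma riemNl p a z : g p (- a) z = - g p a z.
Proof. by have [_ _ _ h _] := linearPE (riem_linearl hg p z). Qed.
Lemma riem0l p z : g p 0 z = 0.
Proof. by have [h _ _ _ _] := linearPE (riem_linearl hg p z). Qed.

Lemma riem_definite p a : g p a a = 0 -> a = 0.
Proof.
move=> g0; apply/eqP; apply: contraT => /(riem_pos hg p).
by rewrite g0 ltxx.
Qed.

Lemma riem_inj p a b : (forall z, g p a z = g p b z) -> a = b.
Proof.
move=> gab; apply/eqP; rewrite -subr_eq0; apply/eqP; apply: (@riem_definite p).
by rewrite riemDl riemNl gab subrr.
Qed.

(** A row vector a in the kernel of the Gram matrix satisfies g(a, a) = 0, so positivity makes the
    matrix invertible. This provides the existence behind the choices by [xget] in [grad], [tensorA]
    and [tensor_tau]. *)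
Lemma riem_representation p (l : E -> R^o) : linear l ->
  exists a, forall x, g p a x = l x.
Proof.
move=> ll; pose A : 'M[R]_m := \matrix_(i, j) g p (delta_mx 0 i) (delta_mx 0 j).
have gE a j : (a *m A) 0 j = g p a (delta_mx 0 j).
  rewrite mxE (linear_rowE a (riem_linearl hg p (delta_mx 0 j))).
  by apply: eq_bigr => i _; rewrite mxE.
have uA : A \in unitmx.
  rewrite -row_free_unit; apply: inj_row_free => a aA0.
  apply: (@riem_definite p); rewrite (linear_rowE a (riem_linearr hg p a)).
  by apply: big1 => j _; rewrite -gE aA0 mxE scaler0.
exists (\row_j l (delta_mx 0 j) *m invmx A) => x.
rewrite (linear_rowE x (riem_linearr hg p _)) (linear_rowE x ll).
by apply: eq_bigr => j _; rewrite -gE mulmxKV// mxE.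
Qed.

Lemma riem_linear_comp p k (K1 K2 : E -> E) a b : linear K1 -> linear K2 ->
  linear (fun z => k * (g p (K1 z) a + g p (K2 z) b) : R^o).
Proof.
move=> l1 l2 j x y; rewrite l1 l2 !riemDl !riemZl -[j *: _]/(j * _).
by ring.
Qed.

Lemma gradE (f : M -> R) p x : g p (grad g f p) x = dfun (W := R^o) f p x.
Proof.
have ex := riem_representation p (l := dfun (W := R^o) f p) (@linearP _ _ _ _ _).
exact: (xgetPex 0 ex).
Qed.

Lemma hlift1 u a : (hlift nabla u a).1 = a.
Proof. by rewrite (hliftE hM). Qed.

Lemma vertical_part_hlift u a : vertical_part nabla u (hlift nabla u a) = 0.
Proof. by rewrite (hliftE hM) /vertical_part addNr. Qed.

Lemma nabla_direction0 p a : nabla p 0 (ext p a) = 0.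
Proof.
by have [h _ _ _ _] := linearPE (nabla_linearl hn (ext_smooth_at hM p a)).
Qed.

Lemma vertical_part_vlift u a : vertical_part nabla u (vlift u a) = a.
Proof. by rewrite (vliftE hM) /vertical_part /= nabla_direction0 addr0. Qed.

Lemma vertical_part_vpart u w :
  vertical_part nabla u (vpart nabla u w) = vertical_part nabla u w.
Proof. by rewrite (vpartE hM) {1}/vertical_part /= nabla_direction0 addr0. Qed.

Lemma horizontal_vertical_part u w : horizontal nabla u w <->
  vertical_part nabla u w = 0.
Proof. by rewrite /horizontal (nablas_xi hM). Qed.

Lemma sasakiE u w w' : sasaki g nabla u w w' =
  g u.1 w.1 w'.1 + g u.1 (vertical_part nabla u w) (vertical_part nabla u w').
Proof. by rewrite /sasaki !(dprojE hM) !(vcompE hM). Qed.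

Lemma sasaki_horizontal u w w' : vertical_part nabla u w = 0 ->
  sasaki g nabla u w w' = g u.1 w.1 w'.1.
Proof. by move=> w0; rewrite sasakiE w0 riem0l addr0. Qed.

(** Identities between tangent vectors of TM are checked on these two parts; the common term
    Gamma(w.1, u.2) cancels. *)
Lemma tangent_inj u w w' : w.1 = w'.1 ->
  vertical_part nabla u w = vertical_part nabla u w' -> w = w'.
Proof.
case: w w' => [a b] [a' b'] /= ->; rewrite /vertical_part /=.
by move=> /addIr ->.
Qed.

Lemma hpart1 u w : (hpart nabla u w).1 = w.1.
Proof. by rewrite /hpart (hliftE hM) (dprojE hM). Qed.

Lemma curvatureN p x y z : curvature nabla p x y z = - curvature nabla p y x z.
Proof. by rewrite !(curvature_chris hM hn) opprB. Qed.

(** The second slot holds the test vector in the definition of A, so its linearity is what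
    [riem_representation] asks for. *)
Lemma curvature_linear p k x a b z : curvature nabla p x (k *: a + b) z =
  k *: curvature nabla p x a z + curvature nabla p x b z.
Proof.
rewrite !(curvature_chris hM hn).
have nl y := nabla_linearl hn (ext_smooth_at hM p y).
have nr y : linear (fun x => nabla p y (ext p x)).
  by apply: (nabla_linearr hM hn); exact: c1_chart_at hA _.
rewrite !nl nr.
rewrite dchris_linear (dchris_linearl hM hn).
have e (V : lmodType R) (A B C D F G H J : V) :
    (k *: A + B) + (k *: C + D) - ((k *: F + G) + (k *: H + J)) =
    k *: (A + C - (F + H)) + (B + D - (G + J)).
  rewrite scalerBr !scalerDr addrACA [X in _ - X = _]addrACA opprD.
  by rewrite [RHS]addrACA.
exact: e.
Qed.

Lemma torsionN p x y : torsion nabla p x y = - torsion nabla p y x.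
Proof. by rewrite !(torsion_chris hM) opprB. Qed.

Lemma torsion_linear p k x a b : torsion nabla p x (k *: a + b) =
  k *: torsion nabla p x a + torsion nabla p x b.
Proof.
rewrite !(torsion_chris hM).
rewrite (nabla_linearr hM hn); last exact: c1_chart_at hA _.
rewrite (nabla_linearl hn); last exact: ext_smooth_at.
by rewrite scalerBr opprD addrACA.
Qed.

(** The prescribed inner products depend linearly on the horizontal part of Z, so the representative
    of [l], lifted horizontally, meets the condition; positivity of f1 allows dividing by it. *)
Lemma tensorA_spec (f1 f2 : M -> R) u w w' : 0 < f1 u.1 ->
  let W := tensorA g nabla f1 f2 u w w' in
  vertical_part nabla u W = 0 /\ forall z,
    f1 u.1 * g u.1 W.1 z = f2 u.1 / 2 *
      (g u.1 (curvature nabla u.1 w.1 z u.2) (vertical_part nabla u w') +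
       g u.1 (curvature nabla u.1 w'.1 z u.2) (vertical_part nabla u w)).
Proof.
move=> f10 W; pose l z : R^o := f2 u.1 / (2 * f1 u.1) *
      (g u.1 (curvature nabla u.1 w.1 z u.2) (vertical_part nabla u w') +
       g u.1 (curvature nabla u.1 w'.1 z u.2) (vertical_part nabla u w)).
have ll : linear l.
  by apply: riem_linear_comp => k a b; exact: curvature_linear.
have [a aE] := riem_representation u.1 ll.
have f10' : f1 u.1 != 0 by rewrite gt_eqF.
pose P W := horizontal nabla u W /\ forall Z,
    f1 u.1 * sasaki g nabla u W Z = f2 u.1 / 2 *
      (g u.1 (Rstar nabla u (hpart nabla u w) (hpart nabla u Z) (xi u))
         (vcomp nabla u w') +
       g u.1 (Rstar nabla u (hpart nabla u w') (hpart nabla u Z) (xi u))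
         (vcomp nabla u w)).
have PW : P W.
  apply: (xgetPex 0 (P := P)); exists (hlift nabla u a); split.
    exact/horizontal_vertical_part/vertical_part_hlift.
  move=> Z; rewrite sasaki_horizontal ?vertical_part_hlift// hlift1 aE /l.
  rewrite /Rstar !(dprojE hM) !hpart1 !(vcompE hM) /xi.
  by field.
(* Of the chosen W only the defining property is kept; testing it on horizontal lifts gives the
   formula for every z. *)
clearbody W; case: PW => /horizontal_vertical_part W0 WE; split=> // z.
have := WE (hlift nabla u z); rewrite (sasaki_horizontal _ W0).
by rewrite /Rstar !(dprojE hM) !hpart1 !(vcompE hM) !hlift1.
Qed.

Lemma tensor_tau_spec u w w' :
  let W := tensor_tau g nabla u w w' in
  vertical_part nabla u W = 0 /\ forall z,
    g u.1 W.1 z = 2^-1 *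
      (g u.1 (torsion nabla u.1 w'.1 w.1) z +
       g u.1 (torsion nabla u.1 w.1 z) w'.1 +
       g u.1 (torsion nabla u.1 w'.1 z) w.1).
Proof.
pose T3 x y z := g u.1 (torsion nabla u.1 x y) z.
have T3E X Y Z : torsion3 g nabla u X Y Z = T3 X.1 Y.1 Z.1.
  rewrite /torsion3 sasaki_horizontal ?vertical_part_hlift//.
  by rewrite !(dprojE hM) hlift1.
move=> W; pose l z : R^o :=
  2^-1 * (T3 w'.1 w.1 z + T3 w.1 z w'.1 + T3 w'.1 z w.1).
have ll : linear l.
  (* z is in the metric slot of the first summand and in a torsion slot of the other two, so only
     the latter have the shape of [riem_linear_comp]. *)
  have e : l = (fun z => 2^-1 * g u.1 (torsion nabla u.1 w'.1 w.1) z : R^o) \+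
    (fun z => 2^-1 * (g u.1 (torsion nabla u.1 w.1 z) w'.1 +
                      g u.1 (torsion nabla u.1 w'.1 z) w.1) : R^o).
    by apply/funext => z; rewrite /l -addrA mulrDr.
  have l2 := riem_linear_comp u.1 2^-1 w'.1 w.1
    (torsion_linear u.1 ^~ w.1) (torsion_linear u.1 ^~ w'.1).
  have l1 := riem_linearr hg u.1 (torsion nabla u.1 w'.1 w.1).
  rewrite e => k a b; rewrite /= l1 l2 -![k *: _]/(k * _).
  ring.
have [a aE] := riem_representation u.1 ll.
pose P W := horizontal nabla u W /\ forall Z,
    sasaki g nabla u W (hpart nabla u Z) =
      2^-1 * (torsion3 g nabla u w' w Z + torsion3 g nabla u w Z w' +
              torsion3 g nabla u w' Z w).
have PW : P W.
  apply: (xgetPex 0 (P := P)); exists (hlift nabla u a); split.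
    exact/horizontal_vertical_part/vertical_part_hlift.
  move=> Z; rewrite sasaki_horizontal ?vertical_part_hlift// hlift1 aE /l.
  by rewrite !T3E hpart1.
clearbody W; case: PW => /horizontal_vertical_part W0 WE; split=> // z.
have := WE (hlift nabla u z); rewrite (sasaki_horizontal _ W0).
by rewrite !T3E hpart1 hlift1.
Qed.

End SasakiConnection.

(** * Product rule and torsion of the right-hand side, and the comparison *)

Definition conformal_factor (R : realType) (T : Type) (phi : T -> R) p := expR (2 * phi p).

Section LeviCivita.
Context {R : realType} {m : nat} (M : chartedSpace 'rV[R]_m).
Hypothesis hM : is_manifold M.
Let hA := manifold_c1 hM.
Local Notation E := 'rV[R]_m.
Local Notation N := (TM M).
Variable g : M -> E -> E -> R.
Hypothesis hg : is_riemannian g.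
Variable nabla : M -> E -> (M -> E) -> E.
Hypothesis hn : is_connection nabla.
Hypothesis hgn : is_metric_for g nabla.
Variables phi1 phi2 : M -> R.
Hypotheses (sphi1 : smooth (W := R^o) phi1) (sphi2 : smooth (W := R^o) phi2).
Implicit Types (p q : M) (u : N) (w : (E * E)%type) (X Y Z : N -> (E * E)%type).
Implicit Types (a b x y z c : E).

Local Notation f1 := (conformal_factor phi1).
Local Notation f2 := (conformal_factor phi2).
Local Notation G := (sasaki_weighted g nabla f1 f2).
Local Notation vp := (vertical_part nabla).
Local Notation dphi := (dfun (W := R^o)).

Definition sasaki_conn u w Y : (E * E)%type :=
  Dstar g nabla phi1 phi2 u w Y - 2^-1 *: Rxi nabla u w (Y u)
  + tensorA g nabla f1 f2 u w (Y u) + tensorB g nabla phi2 f1 f2 u w (Y u)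
  + tensor_tau g nabla u w (Y u).

Lemma dliftE (phi : M -> R) u w : smooth (W := R^o) phi ->
  dlift phi u w = dphi phi u.1 w.1.
Proof.
move=> sphi; have := smooth_at_differentiable (sphi u.1).
by move=> /dfun_comp_proj dp; exact: (is_diffE w dp).
Qed.

Lemma nablaV_def u w s :
  nablaV nabla phi2 u w s = nablas nabla u w s + dphi phi2 u.1 w.1 *: s u.
Proof. by rewrite /nablaV dliftE. Qed.

Lemma Dstar1 u w Y : (Dstar g nabla phi1 phi2 u w Y).1 =
  nablaH g nabla phi1 u w (fun u' => dproj u' (Y u')).
Proof.
rewrite /Dstar (vliftE hM) (hliftE hM).
by move: (nablaH _ _ _ _ _ _) (nabla _ _ _) => a b; exact: addr0.
Qed.

Lemma Dstar_vertical u w Y : vp u (Dstar g nabla phi1 phi2 u w Y) =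
  nablaV nabla phi2 u w (fun u' => vcomp nabla u' (Y u')).
Proof.
have [_ vD _ _ _] := linearPE (vertical_part_linear hM hn u).
by rewrite /Dstar vD (vertical_part_hlift hM) (vertical_part_vlift hM hn) add0r.
Qed.

Lemma tensorB1 u w w' : (tensorB g nabla phi2 f1 f2 u w w').1 =
  - ((f2 u.1 / f1 u.1 * g u.1 (vp u w) (vp u w')) *: grad g phi2 u.1).
Proof.
rewrite /tensorB (sasakiE hM) !(vertical_part_vpart hM hn) !(vpartE hM).
rewrite (riem0l hg) add0r (hliftE hM).
have e (k l : R) (a b : E * E) : (k *: a - l *: b).1 = k *: a.1 - l *: b.1 by [].
by rewrite e scaler0 sub0r.
Qed.

Lemma tensorB_vertical u w w' : vp u (tensorB g nabla phi2 f1 f2 u w w') =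
  dphi phi2 u.1 w'.1 *: vp u w.
Proof.
have [_ _ vZ _ vB] := linearPE (vertical_part_linear hM hn u).
rewrite /tensorB vB !vZ (vertical_part_vpart hM hn) (vertical_part_hlift hM).
by rewrite scaler0 subr0 dliftE.
Qed.

Lemma sasaki_conn1 u w Y : (sasaki_conn u w Y).1 =
  nablas nabla u w (fun u' => dproj u' (Y u')) + C1 g phi1 u.1 w.1 (Y u).1
  + (tensorA g nabla f1 f2 u w (Y u)).1
  - (f2 u.1 / f1 u.1 * g u.1 (vp u w) (vp u (Y u))) *: grad g phi2 u.1
  + (tensor_tau g nabla u w (Y u)).1.
Proof.
have e (a b c d e : E * E) :
  (a - 2^-1 *: b + c + d + e).1 = a.1 - 2^-1 *: b.1 + c.1 + d.1 + e.1 by [].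
rewrite /sasaki_conn e Dstar1 tensorB1 /Rxi (vliftE hM) /= scaler0 subr0.
by rewrite /nablaH !(dprojE hM).
Qed.

(** Besides D^*, only the curvature term and the first half of B contribute: A, tau and the gradient
    term are horizontal. *)
Lemma sasaki_conn_vertical u w Y : vp u (sasaki_conn u w Y) =
  nablas nabla u w (fun u' => vcomp nabla u' (Y u'))
  + dphi phi2 u.1 w.1 *: vp u (Y u)
  - 2^-1 *: curvature nabla u.1 w.1 (Y u).1 u.2
  + dphi phi2 u.1 (Y u).1 *: vp u w.
Proof.
have [_ vD vZ vN _] := linearPE (vertical_part_linear hM hn u).
have e (a b c d e : E * E) : vp u (a - 2^-1 *: b + c + d + e) =
   vp u a - 2^-1 *: vp u b + vp u c + vp u d + vp u e by rewrite !vD vN vZ.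
have f10 : 0 < f1 u.1 by exact: expR_gt0.
have [A0 _] := tensorA_spec hM hg hn f2 w (Y u) f10.
have [t0 _] := tensor_tau_spec hM hg hn u w (Y u).
rewrite /sasaki_conn e A0 t0 !addr0 Dstar_vertical tensorB_vertical.
rewrite /Rxi (vertical_part_vlift hM hn) nablaV_def (vcompE hM).
by rewrite /Rstar !(dprojE hM).
Qed.

(** A, tau and the gradients are known through their inner products; pairing with z turns the
    remaining horizontal identities into scalar ones. *)
Lemma riem_sasaki_conn1 u w Y z : g u.1 (sasaki_conn u w Y).1 z =
  g u.1 (nablas nabla u w (fun u' => dproj u' (Y u'))) z
  + dphi phi1 u.1 w.1 * g u.1 (Y u).1 z + dphi phi1 u.1 (Y u).1 * g u.1 w.1 z
  - g u.1 w.1 (Y u).1 * dphi phi1 u.1 z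
  + f2 u.1 / f1 u.1 / 2 *
    (g u.1 (curvature nabla u.1 w.1 z u.2) (vp u (Y u)) +
     g u.1 (curvature nabla u.1 (Y u).1 z u.2) (vp u w))
  - f2 u.1 / f1 u.1 * g u.1 (vp u w) (vp u (Y u)) * dphi phi2 u.1 z
  + 2^-1 * (g u.1 (torsion nabla u.1 (Y u).1 w.1) z +
       g u.1 (torsion nabla u.1 w.1 z) (Y u).1 +
       g u.1 (torsion nabla u.1 (Y u).1 z) w.1).
Proof.
have f10 : 0 < f1 u.1 by exact: expR_gt0.
have [_ /(_ z) eA] := tensorA_spec hM hg hn f2 w (Y u) f10.
have [_ /(_ z) et] := tensor_tau_spec hM hg hn u w (Y u).
have f10' : f1 u.1 != 0 by rewrite gt_eqF.
have e p (n c A t gr : E) (k : R) : g p (n + c + A - k *: gr + t) z =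
    g p n z + g p c z + g p A z - k * g p gr z + g p t z.
  by rewrite !(riemDl hg) (riemNl hg) (riemZl hg).
rewrite sasaki_conn1 e et (gradE hg); congr (_ + _ - _ + _); last first.
  move: eA; move: (g _ _.1 z) (_ + _) => A B eA.
  rewrite -[A](mulKf f10') eA; move: f10'; move: (f1 u.1) (f2 u.1) => F1 F2 h.
  by field.
have e' p (a b gr : E) (k l j : R) : g p (k *: a + l *: b - j *: gr) z =
    k * g p a z + l * g p b z - j * g p gr z.
  by rewrite !(riemDl hg) (riemNl hg) !(riemZl hg).
by rewrite /C1 e' (gradE hg) !addrA.
Qed.

Lemma riem_sasaki_conn_vertical u w Y b : g u.1 (vp u (sasaki_conn u w Y)) b =
  g u.1 (nablas nabla u w (fun u' => vcomp nabla u' (Y u'))) b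
  + dphi phi2 u.1 w.1 * g u.1 (vp u (Y u)) b
  - 2^-1 * g u.1 (curvature nabla u.1 w.1 (Y u).1 u.2) b
  + dphi phi2 u.1 (Y u).1 * g u.1 (vp u w) b.
Proof.
have e p (n y K x : E) (k l j : R) :
    g p (n + k *: y - l *: K + j *: x) b =
    g p n b + k * g p y b - l * g p K b + j * g p x b.
  by rewrite !(riemDl hg) (riemNl hg) !(riemZl hg).
by rewrite sasaki_conn_vertical e.
Qed.

Lemma is_diff_conformal_factor (phi : M -> R) u : smooth (W := R^o) phi ->
  is_diff (chart_map (chart_at u) u)
    ((fun u' : N => conformal_factor phi u'.1 : R^o) \o chart_inv (chart_at u))
    (fun w => conformal_factor phi u.1 * (2 * dphi phi u.1 w.1)).
Proof.
move=> sphi; have dp := dfun_comp_proj (smooth_at_differentiable (sphi u.1)).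
have := is_diff_expR (is_diffZ 2 dp).
have e := c1_mapK (TM_c1 hM) (p := u) (c1_chart_at (TM_c1 hM) u).
move=> dE; apply: is_diff_eq dE _; apply/funext => w; congr (_ * _).
by rewrite -[LHS]/(expR (2 * phi (chart_inv (chart_at u)
  (chart_map (chart_at u) u)).1)) e.
Qed.

Lemma sasaki_weightedE u w w' : G u w w' =
  f1 u.1 * g u.1 w.1 w'.1 + f2 u.1 * g u.1 (vp u w) (vp u w').
Proof. by rewrite /sasaki_weighted !(dprojE hM) !(vcompE hM). Qed.

Lemma dfun_sasaki_weighted u w Y Z :
  smooth_field_at u Y -> smooth_field_at u Z ->
  dfun (W := R^o) (fun u' => G u' (Y u') (Z u')) u w =
  f1 u.1 * (g u.1 (nablas nabla u w (fun u' => dproj u' (Y u'))) (Z u).1 +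
    g u.1 (Y u).1 (nablas nabla u w (fun u' => dproj u' (Z u'))))
  + f1 u.1 * (2 * dphi phi1 u.1 w.1) * g u.1 (Y u).1 (Z u).1
  + f2 u.1 * (g u.1 (nablas nabla u w (fun u' => vcomp nabla u' (Y u')))
                (vp u (Z u)) +
    g u.1 (vp u (Y u)) (nablas nabla u w (fun u' => vcomp nabla u' (Z u'))))
  + f2 u.1 * (2 * dphi phi2 u.1 w.1) * g u.1 (vp u (Y u)) (vp u (Z u)).
Proof.
move=> sY sZ.
have d1 := is_diff_metric hM hg hgn (is_diff_dproj hM sY) (is_diff_dproj hM sZ).
have d2 := is_diff_metric hM hg hgn (is_diff_vcomp hM hn sY)
  (is_diff_vcomp hM hn sZ).
have := is_diffD (is_diff_scale (is_diff_conformal_factor u sphi1) d1)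
   (is_diff_scale (is_diff_conformal_factor u sphi2) d2).
move=> /(is_diffE w) e.
(* [T] abstracts the occurrences of u that differentiation leaves as [chart_inv] of [chart_map] of
   u, so that one rewrite removes them all. *)
pose T (u0 : N) : R :=
  f1 u.1 * (2 * dphi phi1 u.1 w.1) * g u0.1 (dproj u0 (Y u0)) (dproj u0 (Z u0)) +
  f1 u0.1 * (g u.1 (nablas nabla u w (fun u' => dproj u' (Y u'))) (dproj u (Z u))
    + g u.1 (dproj u (Y u)) (nablas nabla u w (fun u' => dproj u' (Z u')))) +
  (f2 u.1 * (2 * dphi phi2 u.1 w.1) *
     g u0.1 (vcomp nabla u0 (Y u0)) (vcomp nabla u0 (Z u0)) +
   f2 u0.1 * (g u.1 (nablas nabla u w (fun u' => vcomp nabla u' (Y u')))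
     (vcomp nabla u (Z u)) +
   g u.1 (vcomp nabla u (Y u))
     (nablas nabla u w (fun u' => vcomp nabla u' (Z u'))))).
transitivity (T (chart_inv (chart_at u) (chart_map (chart_at u) u))).
  exact: e.
rewrite (c1_mapK (TM_c1 hM)); last exact: c1_chart_at (TM_c1 hM) u.
rewrite /T !(dprojE hM) !(vcompE hM).
have perm (a b c d : R) : a + b + (c + d) = b + a + d + c by ring.
exact: perm.
Qed.

Lemma riem_curvatureN p x y z a :
  g p (curvature nabla p x y z) a = - g p (curvature nabla p y x z) a.
Proof. by rewrite (curvatureN hM hn) (riemNl hg). Qed.

Lemma riem_torsionN p x y a :
  g p (torsion nabla p x y) a = - g p (torsion nabla p y x) a.
Proof. by rewrite (torsionN hM) (riemNl hg). Qed.

(* ring and field compare atoms up to conversion, which does not terminate in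
   practice on these terms: they are first replaced with variables. *)
Ltac gen_riem := repeat match goal with
  |- context [g ?p ?a ?b] => generalize (g p a b); intro end.

(** The terms w(phi_i) occur once for Y and once for Z, which together gives the derivative 2
    w(phi_i) f_i of each factor; all other corrections cancel between the two products. *)
Lemma sasaki_conn_metric u w Y Z :
  smooth_field_at u Y -> smooth_field_at u Z ->
  dfun (W := R^o) (fun u' => G u' (Y u') (Z u')) u w =
  G u (sasaki_conn u w Y) (Z u) + G u (sasaki_conn u w Z) (Y u).
Proof.
move=> sY sZ; rewrite (dfun_sasaki_weighted w sY sZ).
have := riem_sasaki_conn_vertical u w Z (vp u (Y u)).
have := riem_sasaki_conn1 u w Z (Y u).1.
have := riem_sasaki_conn_vertical u w Y (vp u (Z u)).
have := riem_sasaki_conn1 u w Y (Z u).1.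
have := sasaki_weightedE u (sasaki_conn u w Z) (Y u).
have := sasaki_weightedE u (sasaki_conn u w Y) (Z u).
move: (sasaki_conn u w Y) (sasaki_conn u w Z) => PY PZ -> -> -> -> -> ->.
have f10 : f1 u.1 != 0 by rewrite gt_eqF// expR_gt0.
(* Symmetry of g and skewness of torsion and curvature are oriented so that terms meant to cancel
   are expressed by the same atom. *)
have := riem_curvatureN u.1 (Z u).1 (Y u).1 u.2 (vp u w).
have := riem_torsionN u.1 (Z u).1 w.1 (Y u).1.
have := riem_torsionN u.1 (Z u).1 (Y u).1 w.1.
have := riem_torsionN u.1 (Y u).1 w.1 (Z u).1.
have := riem_sym hg u.1 (Z u).1 (Y u).1.
have := riem_sym hg u.1 (Y u).1 (nablas nabla u w (fun u' => dproj u' (Z u'))).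
have := riem_sym hg u.1 (vp u (Y u))
  (nablas nabla u w (fun u' => vcomp nabla u' (Z u'))).
have := riem_sym hg u.1 (vp u (Z u)) (vp u (Y u)).
move: f10; gen_riem.
move: (dphi phi1 u.1 w.1) => d1w.
move: (dphi phi1 u.1 (Y u).1) (dphi phi1 u.1 (Z u).1) => d1Y d1Z.
move: (dphi phi2 u.1 w.1) => d2w.
move: (dphi phi2 u.1 (Y u).1) (dphi phi2 u.1 (Z u).1) => d2Y d2Z.
move: (f1 u.1) (f2 u.1) => F1 F2 F10.
do 8!move=> ->.
by field.
Qed.

(** In the horizontal part C1, A and the gradient term are symmetric in X and Y, so only nabla^* and
    tau enter the difference. In the vertical part the two phi2 terms exchange roles and drop
    out. *)
Lemma sasaki_conn_torsion u X Y :
  smooth_field_at u X -> smooth_field_at u Y ->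
  sasaki_conn u (X u) Y - sasaki_conn u (Y u) X = lie X Y u.
Proof.
move=> sX sY; have [_ _ _ _ vB] := linearPE (vertical_part_linear hM hn u).
have iu := c1_chart_at hA u.1.
apply: (tangent_inj (nabla := nabla) (u := u)).
  apply: (riem_inj hg (p := u.1)) => z.
  have riemB (a b : E) : g u.1 (a - b) z = g u.1 a z - g u.1 b z.
    by rewrite (riemDl hg) (riemNl hg).
  have nd X' Y' : smooth_field_at u Y' ->
      g u.1 (nablas nabla u (X' u) (fun u' => dproj u' (Y' u'))) z =
      g u.1 (dfield u Y' (X' u)).1 z +
      g u.1 (nabla u.1 (X' u).1 (ext u.1 (Y' u).1)) z.
    move=> sY'; rewrite (nablas_sectionE hM _ _ (is_diff_dproj hM sY')).
    by rewrite (riemDl hg) (dprojE hM).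
  have gl : g u.1 (lie X Y u).1 z =
      g u.1 (dfield u Y (X u)).1 z - g u.1 (dfield u X (Y u)).1 z.
    by rewrite lie_dfield1 riemB.
  have gt : g u.1 (torsion nabla u.1 (Y u).1 (X u).1) z =
      g u.1 (nabla u.1 (Y u).1 (ext u.1 (X u).1)) z -
      g u.1 (nabla u.1 (X u).1 (ext u.1 (Y u).1)) z.
    by rewrite (torsion_chris hM) riemB.
  transitivity (g u.1 (sasaki_conn u (X u) Y).1 z -
      g u.1 (sasaki_conn u (Y u) X).1 z); first exact: riemB.
  apply: (etrans _ (esym gl)).
  move: (riem_torsionN u.1 (X u).1 (Y u).1 z) gt (nd X Y sY) (nd Y X sX).
  move: (riem_sym hg u.1 (vp u (Y u)) (vp u (X u))).
  move: (riem_sym hg u.1 (Y u).1 (X u).1).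
  move: (riem_sasaki_conn1 u (X u) Y z) (riem_sasaki_conn1 u (Y u) X z).
  gen_riem.
  move: (f2 u.1 / f1 u.1) (dphi phi1 u.1 (X u).1) (dphi phi1 u.1 (Y u).1)
    (dphi phi1 u.1 z) (dphi phi2 u.1 z) => k d1 d2 d3 d4.
  move=> -> -> -> -> -> -> -> ->.
  by field.
have nv X' Y' : smooth_field_at u Y' ->
    nablas nabla u (X' u) (fun u' => vcomp nabla u' (Y' u')) =
    (dfield u Y' (X' u)).2 + (dchris nabla u.1 (X' u).1 (Y' u).1 u.2 +
      nabla u.1 (dfield u Y' (X' u)).1 (ext u.1 u.2) +
      nabla u.1 (Y' u).1 (ext u.1 (X' u).2)) +
    (nabla u.1 (X' u).1 (ext u.1 (Y' u).2) +
     nabla u.1 (X' u).1 (ext u.1 (nabla u.1 (Y' u).1 (ext u.1 u.2)))).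
  move=> sY'; rewrite (nablas_sectionE hM _ _ (is_diff_vcomp hM hn sY')).
  have [_ nD _ _ _] := linearPE (nabla_linearr hM hn (X' u).1 iu).
  by rewrite (vcompE hM) {1}/vertical_part nD.
have vl : vp u (lie X Y u) = (dfield u Y (X u)).2 - (dfield u X (Y u)).2 +
    (nabla u.1 (dfield u Y (X u)).1 (ext u.1 u.2) -
     nabla u.1 (dfield u X (Y u)).1 (ext u.1 u.2)).
  have [_ _ _ _ nB] := linearPE (nabla_linearl hn (ext_smooth_at hM u.1 u.2)).
  by rewrite /vertical_part lie_dfield1 lie_dfield2 nB.
apply: (etrans (vB _ _)); apply: (etrans _ (esym vl)).
have cv X' Y' : smooth_field_at u Y' -> vp u (sasaki_conn u (X' u) Y') =
    (dfield u Y' (X' u)).2 + (dchris nabla u.1 (X' u).1 (Y' u).1 u.2 +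
      nabla u.1 (dfield u Y' (X' u)).1 (ext u.1 u.2) +
      nabla u.1 (Y' u).1 (ext u.1 (X' u).2)) +
    (nabla u.1 (X' u).1 (ext u.1 (Y' u).2) +
     nabla u.1 (X' u).1 (ext u.1 (nabla u.1 (Y' u).1 (ext u.1 u.2)))) +
    dphi phi2 u.1 (X' u).1 *: vp u (Y' u) -
    2^-1 *: curvature nabla u.1 (X' u).1 (Y' u).1 u.2 +
    dphi phi2 u.1 (Y' u).1 *: vp u (X' u).
  by move=> sY'; rewrite sasaki_conn_vertical -nv.
apply: (etrans (congr2 (fun a b => a - b) (cv X Y sY) (cv Y X sX))).
(* [d1] and [e1] stand for Gamma(Y.1, X.2) and Gamma(X.1, Y.2): each arises once from
   differentiating the fibre coordinate and once from nabla^*, in opposite orders. The [b] and [h]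
   terms assemble into the curvature [K1]. *)
have e (a1 a2 b1 b2 c1 c2 d1 e1 h1 h2 k1 k2 K1 K2 : E) (l j : R) :
   K1 = b1 + h1 - (b2 + h2) -> K2 = - K1 ->
   a1 + (b1 + c1 + d1) + (e1 + h1) + l *: k1 - 2^-1 *: K1
     + j *: k2 -
   (a2 + (b2 + c2 + e1) + (d1 + h2) + j *: k2
     - 2^-1 *: K2 + l *: k1) = a1 - a2 + (c1 - c2).
  by move=> -> ->; apply/rowP => i; rewrite !mxE; field.
apply: e; last exact: (curvatureN hM hn).
exact: (curvature_chris hM hn _ _ _ _).
Qed.

Lemma sasaki_weighted_definite u w : G u w w = 0 -> w = 0.
Proof.
rewrite sasaki_weightedE => G0.
have pos a : 0 <= g u.1 a a.
  have [->|/(riem_pos hg u.1)/ltW //] := eqVneq a 0.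
  by rewrite (riem0l hg).
have f10 : 0 < f1 u.1 by exact: expR_gt0.
have f20 : 0 < f2 u.1 by exact: expR_gt0.
move: G0 => /eqP; rewrite paddr_eq0 ?mulr_ge0// ?ltW//.
rewrite !mulf_eq0 (gt_eqF f10) (gt_eqF f20) /=.
move=> /andP[/eqP/(riem_definite hg) w1 /eqP/(riem_definite hg) w2].
have [v0 _ _ _ _] := linearPE (vertical_part_linear hM hn u).
by apply: (tangent_inj (nabla := nabla) (u := u)); rewrite ?w2 ?v0.
Qed.

Lemma sasaki_weightedBl u w1 w2 w : G u (w1 - w2) w = G u w1 w - G u w2 w.
Proof.
have [_ _ _ _ vB] := linearPE (vertical_part_linear hM hn u).
have fB (a b : E * E) : (a - b).1 = a.1 - b.1 by [].
have e p (a1 a2 a b1 b2 b : E) (k l : R) :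
    k * g p (a1 - a2) a + l * g p (b1 - b2) b =
    k * g p a1 a + l * g p b1 b - (k * g p a2 a + l * g p b2 b).
  by rewrite !(riemDl hg) !(riemNl hg) !mulrBr opprD addrACA.
by rewrite !sasaki_weightedE vB fB e.
Qed.

Lemma sasaki_weightedC u w1 w2 : G u w1 w2 = G u w2 w1.
Proof.
by rewrite !sasaki_weightedE !(riem_sym hg _ _ w2.1) (riem_sym hg _ _ (vp u w2)).
Qed.

Theorem levi_civita_sasaki nablaG : is_levi_civita G nablaG ->
  forall X Y, smooth_field X -> smooth_field Y ->
  forall u, nablaG u (X u) Y = sasaki_conn u (X u) Y.
Proof.
move=> [_ metG torG] X Y sX sY u.
pose S A B : (E * E)%type := nablaG u (A u) B - sasaki_conn u (A u) B.
have S_sym A B : smooth_field_at u A -> smooth_field_at u B -> S A B = S B A.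
  move=> sA sB; have := torG u A B sA sB.
  have := sasaki_conn_torsion sA sB.
  rewrite /S /torsion_fields => <- /eqP; rewrite subr_eq0 => /eqP.
  move: (nablaG u (A u) B) (nablaG u (B u) A) => a b.
  move: (sasaki_conn u (A u) B) (sasaki_conn u (B u) A) => c d abcd.
  by rewrite -[a](subrK b) abcd addrAC (addrC c) addrK addrC.
have S_anti A B C : smooth_field_at u B -> smooth_field_at u C ->
    G u (S A B) (C u) = - G u (S A C) (B u).
  move=> sB sC; have e1 := metG u (A u) B C sB sC.
  have e2 := sasaki_conn_metric (A u) sB sC.
  have e3 := sasaki_weightedC u (B u) (nablaG u (A u) C).
  have e4 := sasaki_weightedBl u (nablaG u (A u) B)
    (sasaki_conn u (A u) B) (C u).
  have e5 := sasaki_weightedBl u (nablaG u (A u) C)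
    (sasaki_conn u (A u) C) (B u).
  apply: (etrans e4); apply: (etrans _ (esym (congr1 -%R e5))).
  have := etrans (esym e1) e2; have := e3.
  clear; do 5!(match goal with |- context [G ?p ?a ?b] =>
    generalize (G p a b); intro end).
  by move=> ->; lra.
(* Alternating the skew and the symmetric rule, three times each, leads from G(S(A,B), C) to its own
   opposite. *)
have S0 A B C : smooth_field_at u A -> smooth_field_at u B ->
    smooth_field_at u C -> G u (S A B) (C u) = 0.
  move=> sA sB sC.
  have e1 : G u (S A B) (C u) = - G u (S A C) (B u) by exact: S_anti.
  have e2 : G u (S C A) (B u) = - G u (S C B) (A u) by exact: S_anti.
  have e3 : G u (S B C) (A u) = - G u (S B A) (C u) by exact: S_anti.
  have e4 := congr1 (fun w => G u w (B u)) (S_sym C A sC sA).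
  have e5 := congr1 (fun w => G u w (A u)) (S_sym C B sC sB).
  have e6 := congr1 (fun w => G u w (C u)) (S_sym B A sB sA).
  move: e1 e2 e3 e4 e5 e6 => /=; clear.
  do 6!(match goal with |- context [G ?p ?a ?b] =>
    generalize (G p a b); intro end).
  lra.
(* Definiteness is applied to w paired with itself, so w is extended to a field smooth at u, with
   constant components in the chart at u. *)
pose w := S X Y; pose Z : N -> (E * E)%type := ext u w.
have sZ : smooth_field_at u Z.
  apply: (smooth_at_near (f := cst w)); last exact: smooth_at_cst.
  have iu := c1_chart_at (TM_c1 hM) u.
  apply: filterS (nearM_dom (TM_c1 hM) iu iu) => z iz.
  by rewrite /Z /ext (unrepK (TM_c1 hM)).
have := S0 X Y Z (sX u) (sY u) sZ.
rewrite /Z /ext (unrep_at (TM_c1 hM)) => /sasaki_weighted_definite.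
by move=> /eqP; rewrite subr_eq0 => /eqP.
Qed.

End LeviCivita.

Theorem theorem0p1 (R : realType) (m : nat) (hm : (2 <= m)%N)
    (M : chartedSpace 'rV[R]_m) (hM : is_manifold M)
    (g : M -> 'rV[R]_m -> 'rV[R]_m -> R) (hg : is_riemannian g)
    (nabla : M -> 'rV[R]_m -> (M -> 'rV[R]_m) -> 'rV[R]_m)
    (hnabla : is_connection nabla) (hmetric : is_metric_for g nabla)
    (phi1 phi2 : M -> R)
    (hphi1 : smooth (W := R^o) phi1) (hphi2 : smooth (W := R^o) phi2) :
  let f1 := fun p => expR (2 * phi1 p) in
  let f2 := fun p => expR (2 * phi2 p) in
  let G := sasaki_weighted g nabla f1 f2 in
  forall nablaG : TM M -> ('rV[R]_m * 'rV[R]_m)%type ->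
      (TM M -> ('rV[R]_m * 'rV[R]_m)%type) -> ('rV[R]_m * 'rV[R]_m)%type,
  is_levi_civita G nablaG ->
  forall X Y : TM M -> ('rV[R]_m * 'rV[R]_m)%type,
  smooth_field X -> smooth_field Y ->
  forall u : TM M,
    nablaG u (X u) Y =
      Dstar g nabla phi1 phi2 u (X u) Y
      - 2^-1 *: Rxi nabla u (X u) (Y u)
      + tensorA g nabla f1 f2 u (X u) (Y u)
      + tensorB g nabla phi2 f1 f2 u (X u) (Y u)
      + tensor_tau g nabla u (X u) (Y u).
Proof.
move=> f1 f2 G nablaG LC X Y sX sY u.
(* The local [f1] and [f2] are convertible to the [conformal_factor] of [phi1] and [phi2], and the
   right-hand side to [sasaki_conn]. *)
exact: (levi_civita_sasaki hM hg hnabla hmetric hphi1 hphi2 LC sX sY u).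
Qed.
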